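(* For every integer $n\ge 2$, $\mathrm{LF}(\mathbb{H}^n) \approx \mathrm{LF}(\mathbb{R}^n)$.
   Context: $\mathbb{H}^n$ is hyperbolic $n$-space: the unique simply connected, $n$-dimensional, complete Riemannian manifold of constant sectional curvature $-1$, with its Riemannian distance. $\mathbb{R}^n$ carries the Euclidean metric. For a metric space $X$ with a chosen basepoint, $\mathrm{Lip}_0(X)$ is the Banach space of real Lipschitz functions vanishing at the basepoint, normed by the Lipschitz constant; the Lipschitz free space $\mathrm{LF}(X)$ is the closed linear span in $\mathrm{Lip}_0(X)^*$ of the evaluation functionals $\delta_x$, $x\in X$ (its isometry type does not depend on the basepoint). $V\approx W$ means that the real Banach spaces $V,W$ are isomorphic (bounded linear isomorphism). *)

(* Defs.v *)
From HB Require Import structures.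
From mathcomp Require Import all_boot all_order all_algebra.
From mathcomp Require Import all_classical all_reals all_analysis.
From mathcomp Require Import ring lra.
Set Implicit Arguments.
Unset Strict Implicit.
Unset Printing Implicit Defensive.
Import Order.TTheory GRing.Theory Num.Theory.
Import numFieldNormedType.Exports.
Local Open Scope classical_set_scope.
Local Open Scope ring_scope.

(* The norm of the library on 'rV[R]_n is the sup norm, and its default metric
   is the associated one; hence a Euclidean norm, and a type alias carrying the
   Euclidean metric. *)
Section euclidean_norm.
Context {R : realType} {n : nat}.
Implicit Types u v : 'rV[R]_n.

Definition enorm v : R := Num.sqrt (\sum_i v 0 i ^+ 2).

Let sumsq_ge0 v : 0 <= \sum_i v 0 i ^+ 2.
Proof. by apply: sumr_ge0 => i _; exact: sqr_ge0. Qed.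

Lemma sqr_enorm v : enorm v ^+ 2 = \sum_i v 0 i ^+ 2.
Proof. exact: sqr_sqrtr. Qed.

Lemma enorm_ge0 v : 0 <= enorm v.
Proof. exact: sqrtr_ge0. Qed.

Lemma coord_le_enorm v i : `|v 0 i| <= enorm v.
Proof.
rewrite -sqrtr_sqr ler_wsqrtr// (bigD1 i)//= lerDl.
by apply: sumr_ge0 => j _; exact: sqr_ge0.
Qed.

Lemma enorm0 : enorm 0 = 0.
Proof. by rewrite /enorm big1 ?sqrtr0// => i _; rewrite mxE expr0n. Qed.

Lemma enorm_eq0 v : enorm v = 0 -> v = 0.
Proof.
move=> v0; apply/rowP => i; rewrite mxE; apply/eqP.
by rewrite -normr_le0 -v0 coord_le_enorm.
Qed.

Lemma enormZ a v : enorm (a *: v) = `|a| * enorm v.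
Proof.
rewrite /enorm -sqrtr_sqr -sqrtrM ?sqr_ge0// mulr_sumr; congr Num.sqrt.
by apply: eq_bigr => i _; rewrite mxE exprMn.
Qed.

Lemma enormN v : enorm (- v) = enorm v.
Proof. by rewrite -scaleN1r enormZ normrN1 mul1r. Qed.

Lemma cauchy_schwarz u v :
  (\sum_i u 0 i * v 0 i) ^+ 2 <= enorm u ^+ 2 * enorm v ^+ 2.
Proof.
have [->|v0] := eqVneq v 0.
  rewrite big1 => [|i _]; last by rewrite mxE mulr0.
  by rewrite expr0n; apply: mulr_ge0; exact: sqr_ge0.
have v_gt0 : 0 < enorm v ^+ 2.
  rewrite exprn_gt0// lt_neqAle (enorm_ge0 v) andbT eq_sym.
  by apply: contra v0 => /eqP/enorm_eq0 ->.
rewrite -subr_ge0 -(pmulr_rge0 _ v_gt0).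
set C := \sum_i _; set B := enorm v ^+ 2; set A := enorm u ^+ 2.
suff -> : B * (A * B - C ^+ 2) = \sum_i (B * u 0 i - C * v 0 i) ^+ 2.
  by apply: sumr_ge0 => i _; exact: sqr_ge0.
under eq_bigr => i _.
  have -> : (B * u 0 i - C * v 0 i) ^+ 2 = B ^+ 2 * u 0 i ^+ 2
    + (C ^+ 2 * v 0 i ^+ 2 - 2 * B * C * (u 0 i * v 0 i)) by ring.
  over.
rewrite big_split sumrB /= -!mulr_sumr -!sqr_enorm -/A -/B -/C; ring.
Qed.

Lemma ler_enormD u v : enorm (u + v) <= enorm u + enorm v.
Proof.
rewrite -(@ler_pXn2r _ 2) ?nnegrE ?addr_ge0 ?enorm_ge0//.
have uv : \sum_i u 0 i * v 0 i <= enorm u * enorm v.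
  have [C0|C0] := leP (\sum_i u 0 i * v 0 i) 0.
    by apply: (le_trans C0); rewrite mulr_ge0 ?enorm_ge0.
  rewrite -(@ler_pXn2r _ 2) ?nnegrE ?mulr_ge0 ?enorm_ge0 ?(ltW C0)//.
  by rewrite exprMn cauchy_schwarz.
have -> : enorm (u + v) ^+ 2 =
    enorm u ^+ 2 + enorm v ^+ 2 + 2 * \sum_i u 0 i * v 0 i.
  rewrite !sqr_enorm mulr_sumr -!big_split/=.
  by apply: eq_bigr => i _; rewrite mxE; ring.
nra.
Qed.

Lemma enorm_continuous : continuous (enorm : 'rV[R]_n -> R).
Proof.
have sumsq_continuous (r : seq 'I_n) :
    continuous (fun w : 'rV[R]_n => \sum_(i <- r) w 0 i ^+ 2).
  elim: r => [|i r IHr].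
    have -> : (fun w : 'rV[R]_n => \sum_(i <- [::]) w 0 i ^+ 2) = cst 0.
      by apply/funext => w; rewrite big_nil.
    exact: cst_continuous.
  have -> : (fun w : 'rV[R]_n => \sum_(j <- i :: r) w 0 j ^+ 2) =
      (fun w => w 0 i ^+ 2) + (fun w => \sum_(j <- r) w 0 j ^+ 2).
    by apply/funext => w; rewrite big_cons.
  move=> v; apply: (@continuousD _ _ _ (fun w : 'rV[R]_n => w 0 i ^+ 2));
    last exact: IHr.
  apply: (@continuous_comp _ _ _ (fun w : 'rV[R]_n => w 0 i) (fun x => x ^+ 2)).
    exact: coord_continuous.
  exact: exprn_continuous.
move=> v.
apply: (@continuous_comp _ _ _ (fun w : 'rV[R]_n => \sum_i w 0 i ^+ 2)).
  exact: sumsq_continuous.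
exact: sqrt_continuous.
Qed.

End euclidean_norm.

Definition euclidean (R : realType) (n : nat) : Type := 'rV[R]_n.

Section euclidean_metric.
Context (R : realType) (n : nat).
Implicit Types x y z : euclidean R n.

Definition euclidean_dist x y : R := enorm (x - y : 'rV[R]_n).

Lemma euclidean_distxx x : euclidean_dist x x = 0.
Proof. by rewrite /euclidean_dist subrr enorm0. Qed.

Lemma euclidean_dist_eq0 x y : euclidean_dist x y = 0 -> x = y.
Proof. by move=> /enorm_eq0/subr0_eq. Qed.

Lemma euclidean_dist_sym x y : euclidean_dist x y = euclidean_dist y x.
Proof. by rewrite /euclidean_dist -enormN opprB. Qed.

Lemma euclidean_dist_triangle y x z :
  euclidean_dist x z <= euclidean_dist x y + euclidean_dist y z.
Proof. by rewrite (le_trans _ (ler_enormD _ _))// addrA subrK. Qed.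

HB.instance Definition _ := Choice.copy (euclidean R n) 'rV[R]_n.
HB.instance Definition _ := isMetric.Build R (euclidean R n)
  euclidean_distxx euclidean_dist_eq0 euclidean_dist_sym euclidean_dist_triangle.

End euclidean_metric.

(* Hyperbolic n-space, in the Poincare ball model: the open unit ball of R^n with
   the Riemannian metric 4 |dv|^2 / (1 - |v|^2)^2, which is complete and of
   constant curvature -1. *)
Record hyperbolic (R : realType) (n : nat) :=
  Hyperbolic { hyperbolic_val :> 'rV[R]_n ; _ : enorm hyperbolic_val < 1 }.

HB.instance Definition _ (R : realType) (n : nat) :=
  [isSub of hyperbolic R n for @hyperbolic_val R n].
HB.instance Definition _ (R : realType) (n : nat) :=
  [Choice of hyperbolic R n by <:].

Section hyperbolic_metric.
Context (R : realType) (n : nat).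
Implicit Types (x y z : hyperbolic R n) (c : R -> 'rV[R]_n) (l : R).
Local Notation mu := (@lebesgue_measure R).

(* A C^1 map on [0, 1] extends to a C^1 map on R, so asking for smoothness on the
   whole line loses nothing; only the values on [0, 1] must lie in the ball. *)
Definition C1_arc x y c := [/\ forall t, derivable c t 1, continuous (derive1 c),
  forall t, 0 <= t <= 1 -> enorm (c t) < 1, c 0 = x & c 1 = y].

Definition hyperbolic_speed c (t : R) : R :=
  2 * enorm (derive1 c t) / (1 - enorm (c t) ^+ 2).

Definition hyperbolic_length c : R :=
  \int[mu]_(t in `[0%R, 1%R]) hyperbolic_speed c t.

(* path_length x y l: some piecewise C^1 path from x to y, given as the list of
   its C^1 pieces (each parametrized by [0, 1]), has Riemannian length l. *)
Inductive path_length : hyperbolic R n -> hyperbolic R n -> R -> Prop :=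
| path_nil x : path_length x x 0
| path_cons x y z c l : C1_arc x y c -> path_length y z l ->
    path_length x z (hyperbolic_length c + l).

(* The Riemannian distance. *)
Definition hyperbolic_dist x y : R := inf [set l | path_length x y l].

Lemma conformal_ge2 (v : 'rV[R]_n) : enorm v < 1 -> 0 < 1 - enorm v ^+ 2 <= 1.
Proof. by move=> v1; have v0 := enorm_ge0 v; apply/andP; split; nra. Qed.

Lemma enorm_le_speed x y c t : C1_arc x y c -> 0 <= t <= 1 ->
  enorm (derive1 c t) <= hyperbolic_speed c t.
Proof.
case=> _ _ cB _ _ /cB/conformal_ge2/andP[c0 c1].
by rewrite ler_pdivlMr//; have := enorm_ge0 (derive1 c t); nra.
Qed.

Lemma speed_continuous x y c : C1_arc x y c ->
  {within `[0%R, 1%R], continuous (hyperbolic_speed c)}.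
Proof.
move=> [dc cc cB _ _]; apply: continuous_in_subspaceT => t.
rewrite inE/= in_itv/= => /cB/conformal_ge2/andP[c0 _].
have cet : (fun s : R => enorm (c s)) @ t --> enorm (c t).
  apply: (@continuous_comp _ _ _ c enorm); last exact: enorm_continuous.
  exact/differentiable_continuous/derivable1_diffP.
have cdt : (fun s : R => enorm (derive1 c s)) @ t --> enorm (derive1 c t).
  by apply: (@continuous_comp _ _ _ (derive1 c) enorm);
    [exact: cc|exact: enorm_continuous].
have cft : (fun s : R => 1 - enorm (c s) * enorm (c s)) @ t -->
    1 - enorm (c t) * enorm (c t).
  by apply: cvgB; [exact: cvg_cst|exact: cvgM].
have c_neq0 : 1 - enorm (c t) * enorm (c t) != 0 by rewrite gt_eqF.
exact: (cvgM (cvgM (cvg_cst (2 : R)) cdt) (cvgV c_neq0 cft)).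
Qed.

Lemma speed_integrable x y c : C1_arc x y c ->
  mu.-integrable `[0%R, 1%R] (EFin \o hyperbolic_speed c).
Proof.
move=> xyc; apply: continuous_compact_integrable; first exact: segment_compact.
exact: speed_continuous xyc.
Qed.

Lemma is_derive_coord c (t : R) i :
  derivable c t 1 -> is_derive t 1 (fun s : R => c s 0 i) (derive1 c t 0 i).
Proof.
move=> dc; apply: DeriveDef; first by have /derivable_mxP := dc; exact.
by rewrite derive1E derive_mx// mxE.
Qed.

Lemma is_derive_row c (t : R) (d : 'rV[R]_n) :
  (forall i, is_derive t 1 (fun s : R => c s 0 i) (d 0 i)) -> is_derive t 1 c d.
Proof.
move=> cd; have dc : derivable c t 1.
  by apply/derivable_mxP => i j; rewrite ord1; have [] := cd j.
apply: DeriveDef => //; rewrite derive_mx//; apply/rowP => i; rewrite mxE.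
by have := cd i => ?; rewrite derive_val.
Qed.

Lemma is_derive_rev c (t : R) :
  derivable c (1 - t) 1 ->
  is_derive t 1 (fun s : R => c (1 - s)) (- derive1 c (1 - t)).
Proof.
move=> dc; apply: is_derive_row => i.
rewrite mxE -[X in is_derive _ _ _ X]mulrN1.
apply: (is_derive1_comp (f := fun s => c s 0 i)).
  exact: is_derive_coord.
by apply: is_derive_eq; rewrite add0r mul1r.
Qed.

Lemma coord_dist_le_length x y c i : C1_arc x y c ->
  `|(y : 'rV[R]_n) 0 i - (x : 'rV[R]_n) 0 i| <= hyperbolic_length c.
Proof.
move=> xyc; have [dc cc cB c0 c1] := xyc.
pose f (t : R) : R := derive1 c t 0 i; pose F (t : R) : R := c t 0 i.
have cf : continuous f.
  move=> t; apply: (@continuous_comp _ _ _ (derive1 c)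
    (fun v : 'rV[R]_n => v 0 i)); first exact: cc.
  exact: coord_continuous.
have dF (t : R) : is_derive t 1 F (f t) by exact: is_derive_coord.
have cF : continuous F.
  move=> t; apply: differentiable_continuous; apply/derivable1_diffP.
  exact: ex_derive.
have fint : mu.-integrable `[0%R, 1%R] (EFin \o f).
  apply: continuous_compact_integrable; first exact: segment_compact.
  exact: continuous_subspaceT.
have -> : (y : 'rV[R]_n) 0 i - (x : 'rV[R]_n) 0 i =
    \int[mu]_(t in `[0%R, 1%R]) f t.
  rewrite /Rintegral (@continuous_FTC2 _ f F)//.
  - by rewrite -c0 -c1.
  - exact: continuous_subspaceT.
  - split=> [t _||]; first exact: ex_derive.
      exact/cvg_at_right_filter/cF.
    exact/cvg_at_left_filter/cF.
  - by move=> t _; rewrite derive1E derive_val.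
apply: (le_trans (le_normr_Rintegral _ fint)) => //.
apply: le_Rintegral => //.
- exact: (integrable_norm fint).
- exact: speed_integrable xyc.
- move=> t /=; rewrite in_itv/= => t01.
  by apply: le_trans (enorm_le_speed xyc t01); exact: coord_le_enorm.
Qed.

Lemma length_ge0 x y c : C1_arc x y c -> 0 <= hyperbolic_length c.
Proof.
move=> xyc; apply: Rintegral_ge0 => t /=; rewrite in_itv/= => t01.
exact: le_trans (enorm_ge0 _) (enorm_le_speed xyc t01).
Qed.

Lemma path_length_ge0 x y l : path_length x y l -> 0 <= l.
Proof.
elim=> // {}x {}y z c {}l xyc _ l0.
by rewrite addr_ge0// (length_ge0 xyc).
Qed.

Lemma coord_dist_le_path x y l i : path_length x y l ->
  `|(y : 'rV[R]_n) 0 i - (x : 'rV[R]_n) 0 i| <= l.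
Proof.
elim=> [{}x|{}x {}y z c {}l xyc _ yzl]; first by rewrite subrr normr0.
rewrite (le_trans (ler_distD ((y : 'rV[R]_n) 0 i) _ _))// addrC lerD//.
exact: coord_dist_le_length xyc.
Qed.

Lemma path_cat x y z l m :
  path_length x y l -> path_length y z m -> path_length x z (l + m).
Proof.
move=> xyl; elim: xyl z m => [w|u v w c k uvc _ IH] z m; first by rewrite add0r.
by move=> /IH vzl; rewrite -addrA; exact: path_cons uvc vzl.
Qed.

Lemma arc_rev x y c : C1_arc x y c -> C1_arc y x (fun s => c (1 - s)).
Proof.
move=> [dc cc cB c0 c1]; split.
- by move=> t; have [] := is_derive_rev (dc (1 - t)).
- have -> : derive1 (fun s => c (1 - s)) = (fun t => - derive1 c (1 - t)).
    apply/funext => t; have := is_derive_rev (dc (1 - t)).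
    by move=> ?; rewrite derive1E derive_val.
  move=> t; have t1 : (fun s : R => 1 - s) @ t --> 1 - t.
    by apply: cvgB; [exact: cvg_cst|exact: cvg_id].
  exact: (cvgN (cvg_comp _ _ t1 (cc (1 - t)))).
- by move=> t t01; apply: cB; rewrite /=; lra.
- by rewrite /= subr0.
- by rewrite /= subrr.
Qed.

Lemma length_rev x y c : C1_arc x y c ->
  hyperbolic_length (fun s => c (1 - s)) = hyperbolic_length c.
Proof.
move=> xyc; have [dc cc cB c0 c1] := xyc.
have r01 : 0 <= (1 : R) <= 1 by rewrite ler01 lexx.
have := Rintegration_by_substitution_onem r01 (speed_continuous xyc).
rewrite /unstable.onem subrr /hyperbolic_length => ->.
apply: eq_Rintegral => t _; rewrite /hyperbolic_speed.
have := is_derive_rev (dc (1 - t)).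
by move=> ?; rewrite [in LHS]derive1E derive_val enormN.
Qed.

Lemma path_rev x y l : path_length x y l -> path_length y x l.
Proof.
elim=> [w|u v w c k uvc _ wvk]; first exact: path_nil.
rewrite addrC; apply: path_cat wvk _.
by rewrite -(length_rev uvc) -[X in path_length _ _ X]addr0;
  exact: path_cons (arc_rev uvc) (path_nil _).
Qed.

Definition segment (u v : 'rV[R]_n) (t : R) := u + t *: (v - u).

Lemma segment_arc x y : C1_arc x y (segment x y).
Proof.
case: x y => [u u1] [v v1]; rewrite /C1_arc/=.
have ds (t : R) : is_derive t 1 (segment u v) (v - u).
  apply: is_derive_row => i; rewrite /segment; under eq_fun do rewrite !mxE.
  rewrite !mxE.
  by apply: is_derive_eq; rewrite add0r mul1r scaler0 add0r scaler1.
split.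
- by move=> t; have [] := ds t.
- have -> : derive1 (segment u v) = cst (v - u).
    by apply/funext => t; have := ds t => ?; rewrite derive1E derive_val.
  exact: cst_continuous.
- move=> t /andP[t0 t1].
  have -> : segment u v t = (1 - t) *: u + t *: v.
    by rewrite /segment scalerBr scalerBl scale1r addrCA addrC.
  apply: (le_lt_trans (ler_enormD _ _)); rewrite !enormZ !ger0_norm ?subr_ge0//.
  have [t_lt1|t_ge1] := ltP t 1.
    have : (1 - t) * enorm u < 1 - t by rewrite gtr_pMr ?subr_gt0.
    have : t * enorm v <= t by rewrite ler_piMr // ltW.
    lra.
  have -> : t = 1 by lra.
  by rewrite subrr mul0r add0r mul1r.
- by rewrite /segment scale0r addr0.
- by rewrite /segment scale1r addrC subrK.
Qed.

Let has_inf_path x y : has_inf [set l | path_length x y l].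
Proof.
split; last by exists 0 => l /path_length_ge0.
eexists; exact: path_cons (segment_arc x y) (path_nil _).
Qed.

Lemma hyperbolic_dist_le x y l : path_length x y l -> hyperbolic_dist x y <= l.
Proof. by move=> xyl; apply: ge_inf => //; exact: (has_inf_path x y).2. Qed.

Lemma hyperbolic_distxx x : hyperbolic_dist x x = 0.
Proof.
apply/eqP; rewrite eq_le (hyperbolic_dist_le (path_nil x))/=.
by apply: lb_le_inf; [exists 0; exact: path_nil|move=> l /path_length_ge0].
Qed.

Lemma hyperbolic_dist_eq0 x y : hyperbolic_dist x y = 0 -> x = y.
Proof.
move=> xy0; apply/val_inj/rowP => i; apply/esym/eqP.
rewrite -subr_eq0 -normr_le0 -xy0; apply: lb_le_inf.
  exact: (has_inf_path x y).1.
by move=> l; exact: coord_dist_le_path.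
Qed.

Lemma hyperbolic_dist_sym x y : hyperbolic_dist x y = hyperbolic_dist y x.
Proof. by congr inf; apply/seteqP; split=> l; exact: path_rev. Qed.

Lemma hyperbolic_dist_triangle y x z :
  hyperbolic_dist x z <= hyperbolic_dist x y + hyperbolic_dist y z.
Proof.
apply/ler_addgt0Pr => e e0.
have [l xyl lt_l] := inf_adherent (divr_gt0 e0 (ltr0Sn R 1)) (has_inf_path x y).
have [m yzm lt_m] := inf_adherent (divr_gt0 e0 (ltr0Sn R 1)) (has_inf_path y z).
apply: (le_trans (hyperbolic_dist_le (path_cat xyl yzm))).
by rewrite [e]splitr addrACA lerD// ltW.
Qed.

HB.instance Definition _ := isMetric.Build R (hyperbolic R n)
  hyperbolic_distxx hyperbolic_dist_eq0 hyperbolic_dist_sym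
  hyperbolic_dist_triangle.

End hyperbolic_metric.

Section least_bound.
Context {R : realType} {I : Type}.
Implicit Types u v b : I -> R.

Definition bounded_by u b := exists K, forall i, `|u i| <= K * b i.

(* The least K >= 0 with |u i| <= K * b i for all i. With u = f x - f y and
   b = mdist x y indexed by (x, y), this is the Lipschitz constant of f; with
   b = |v| indexed by v, it is the operator norm. *)
Definition least_bound u b : R :=
  inf [set K | 0 <= K /\ forall i, `|u i| <= K * b i].

Lemma least_bound_ge0 u b : 0 <= least_bound u b.
Proof.
rewrite /least_bound; set S := [set _ | _].
have [->|/set0P S0] := eqVneq S set0; first by rewrite inf0.
by apply: lb_le_inf => // K [].
Qed.

Lemma least_bound_le u b K :
  0 <= K -> (forall i, `|u i| <= K * b i) -> least_bound u b <= K.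
Proof. by move=> K0 uK; apply: ge_inf; [exists 0 => ? []|split]. Qed.

Context (b : I -> R) (b_ge0 : forall i, 0 <= b i).

Lemma bounded_by_nneg u :
  bounded_by u b -> exists2 K, 0 <= K & forall i, `|u i| <= K * b i.
Proof.
move=> [K uK]; exists (Num.max 0 K); first by rewrite le_max lexx.
by move=> i; apply: (le_trans (uK i)); rewrite ler_wpM2r// le_max lexx orbT.
Qed.

Lemma least_boundP u i : bounded_by u b -> `|u i| <= least_bound u b * b i.
Proof.
move=> /bounded_by_nneg[K K0 uK].
have := b_ge0 i; rewrite le_eqVlt => /predU1P[b0|b0].
  by have := uK i; rewrite -b0 !mulr0.
rewrite -ler_pdivrMr//; apply: lb_le_inf; first by exists K.
by move=> L [_ uL]; rewrite ler_pdivrMr.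
Qed.

Lemma least_boundD u v : bounded_by u b -> bounded_by v b ->
  least_bound (fun i => u i + v i) b <= least_bound u b + least_bound v b.
Proof.
move=> ub vb; apply: least_bound_le; first by rewrite addr_ge0// least_bound_ge0.
by move=> i; rewrite (le_trans (ler_normD _ _))// mulrDl lerD// least_boundP.
Qed.

Lemma least_boundZ u a : bounded_by u b ->
  least_bound (fun i => a * u i) b = `|a| * least_bound u b.
Proof.
move=> ub; have le_boundZ c w : bounded_by w b ->
    least_bound (fun i => c * w i) b <= `|c| * least_bound w b.
  move=> wb; apply: least_bound_le; first by rewrite mulr_ge0// least_bound_ge0.
  by move=> i; rewrite normrM -mulrA ler_wpM2l// least_boundP.
apply/eqP; rewrite eq_le le_boundZ//=.
have [->|a0] := eqVneq a 0; first by rewrite normr0 mul0r least_bound_ge0.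
rewrite -ler_pdivlMl ?normr_gt0// -normfV.
have aub : bounded_by (fun i => a * u i) b.
  have [K uK] := ub; exists (`|a| * K) => i.
  by rewrite normrM -mulrA ler_wpM2l.
have := le_boundZ a^-1 _ aub; congr (least_bound _ _ <= _).
by apply/funext => i; rewrite mulKf.
Qed.

Lemma least_bound_eq0 u :
  bounded_by u b -> least_bound u b = 0 -> forall i, u i = 0.
Proof.
move=> ub u0 i; apply/eqP; rewrite -normr_le0.
by have := least_boundP i ub; rewrite u0 mul0r.
Qed.

End least_bound.

Section lipschitz_functions.
Context {R : realType} {X : metricType R} (o : X).

Definition lip0_pred : {pred X -> R} := fun f =>
  `[< f o = 0 /\ exists K, forall x y, `|f x - f y| <= K * mdist x y >].

Record Lip0 := MkLip0 { lip0_fun :> X -> R ; _ : lip0_fun \in lip0_pred }.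

HB.instance Definition _ := [isSub of Lip0 for lip0_fun].
HB.instance Definition _ := [Choice of Lip0 by <:].

Lemma lip0_submod_closed : submod_closed lip0_pred.
Proof.
split => [|a f g /asboolP[fo [K fK]] /asboolP[go [L gL]]]; apply/asboolP.
  by split=> //; exists 0 => x y; rewrite subrr normr0 mul0r.
split; first by rewrite !fctE fo go scaler0 addr0.
exists (`|a| * K + L) => x y; rewrite !fctE.
rewrite opprD addrACA -scalerBr mulrDl (le_trans (ler_normD _ _))// lerD//.
by rewrite normrM -mulrA ler_wpM2l.
Qed.

HB.instance Definition _ :=
  GRing.isSubmodClosed.Build _ _ lip0_pred lip0_submod_closed.
HB.instance Definition _ := [SubChoice_isSubLmodule of Lip0 by <:].

Definition lip_norm (f : Lip0) : R :=
  least_bound (fun p : X * X => f p.1 - f p.2) (fun p => mdist p.1 p.2).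

Let mdist2_ge0 (p : X * X) : 0 <= mdist p.1 p.2. Proof. exact: mdist_ge0. Qed.

Lemma Lip0_base (f : Lip0) : f o = 0.
Proof. by case: f => f /= /asboolP[]. Qed.

Lemma Lip0_bounded (f : Lip0) :
  bounded_by (fun p : X * X => f p.1 - f p.2) (fun p => mdist p.1 p.2).
Proof. by case: f => f /= /asboolP[_ [K fK]]; exists K => -[]. Qed.

Lemma lip_normP (f : Lip0) x y : `|f x - f y| <= lip_norm f * mdist x y.
Proof. exact: (least_boundP mdist2_ge0 (x, y) (Lip0_bounded f)). Qed.

Lemma ler_lip_normD f g : lip_norm (f + g) <= lip_norm f + lip_norm g.
Proof.
have := least_boundD mdist2_ge0 (Lip0_bounded f) (Lip0_bounded g).
congr (least_bound _ _ <= _); apply/funext => p.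
by rewrite -[LHS]/(f p.1 - f p.2 + (g p.1 - g p.2)) addrACA -opprD.
Qed.

Lemma lip_normZ a f : lip_norm (a *: f) = `|a| * lip_norm f.
Proof.
rewrite -(least_boundZ mdist2_ge0 a (Lip0_bounded f)); congr least_bound.
by apply/funext => p; rewrite mulrBr.
Qed.

Lemma lip_norm_eq0 f : lip_norm f = 0 -> f = 0.
Proof.
move=> /(least_bound_eq0 mdist2_ge0 (Lip0_bounded f)) f0.
apply/val_inj/funext => x; have /eqP := f0 (x, o).
by rewrite /= Lip0_base subr0 => /eqP.
Qed.

HB.instance Definition _ :=
  Lmodule_isNormed.Build R Lip0 ler_lip_normD lip_normZ lip_norm_eq0.

End lipschitz_functions.

Section dual_space.
Context {R : realType} (V : normedModType R).

Definition dual_pred : {pred V -> R} := fun phi =>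
  `[< scalar phi /\ exists K, forall v, `|phi v| <= K * `|v| >].

Record dual_space := MkDual { dual_fun :> V -> R ; _ : dual_fun \in dual_pred }.

HB.instance Definition _ := [isSub of dual_space for dual_fun].
HB.instance Definition _ := [Choice of dual_space by <:].

Lemma dual_submod_closed : submod_closed dual_pred.
Proof.
split => [|a f g /asboolP[lf [K fK]] /asboolP[lg [L gL]]]; apply/asboolP; split.
- by move=> c u v; rewrite -[RHS]/(c * 0 + 0) mulr0 addr0.
- by exists 0 => v; rewrite normr0 mul0r.
- move=> c u v; rewrite !fctE lf lg /GRing.scale/=; ring.
exists (`|a| * K + L) => v; rewrite !fctE.
rewrite mulrDl (le_trans (ler_normD _ _))// lerD//.
by rewrite normrM -mulrA ler_wpM2l.
Qed.

HB.instance Definition _ :=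
  GRing.isSubmodClosed.Build _ _ dual_pred dual_submod_closed.
HB.instance Definition _ := [SubChoice_isSubLmodule of dual_space by <:].

Definition dual_norm (phi : dual_space) : R := least_bound phi (@Num.norm R V).

Lemma dual_bounded (phi : dual_space) : bounded_by phi (@Num.norm R V).
Proof. by case: phi => phi /= /asboolP[]. Qed.

Lemma dual_scalar (phi : dual_space) : scalar phi.
Proof. by case: phi => phi /= /asboolP[]. Qed.

Lemma ler_dual_normD f g : dual_norm (f + g) <= dual_norm f + dual_norm g.
Proof.
exact: (least_boundD (@normr_ge0 _ _) (dual_bounded f) (dual_bounded g)).
Qed.

Lemma dual_normZ a f : dual_norm (a *: f) = `|a| * dual_norm f.
Proof. exact: (least_boundZ (@normr_ge0 _ _) a (dual_bounded f)). Qed.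

Lemma dual_norm_eq0 f : dual_norm f = 0 -> f = 0.
Proof.
move=> /(least_bound_eq0 (@normr_ge0 _ _) (dual_bounded f)) f0.
exact/val_inj/funext.
Qed.

HB.instance Definition _ :=
  Lmodule_isNormed.Build R dual_space ler_dual_normD dual_normZ dual_norm_eq0.

End dual_space.

Section closed_span.
Context {R : realType} {V : normedModType R}.
Implicit Type S : set V.

Definition lspan S : set V := [set v | exists2 s : seq (R * V),
  (forall p, p \in s -> S p.2) & v = \sum_(p <- s) p.1 *: p.2].

Definition closed_span S : {pred V} := [pred v | v \in closure (lspan S)].

Lemma lspan_lin S a u v : lspan S u -> lspan S v -> lspan S (a *: u + v).
Proof.
move=> [s sS ->] [t tS ->].
exists ([seq (a * p.1, p.2) | p <- s] ++ t) => [p|].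
  by rewrite mem_cat => /orP[/mapP[q /sS qS ->]|/tS].
rewrite big_cat big_map scaler_sumr; congr (_ + _).
by under [RHS]eq_bigr do rewrite -scalerA.
Qed.

Lemma closed_span_approx S v :
  v \in closed_span S <-> forall e, 0 < e -> exists2 w, lspan S w & `|v - w| < e.
Proof.
rewrite !inE; split => [cv e e0|cv B /nbhs_ballP[e /= e0 eB]].
  have [w [Sw]] := cv _ (nbhsx_ballx v e e0).
  by rewrite -ball_normE; exists w.
by have [w Sw vw] := cv e e0; exists w; split=> //; apply: eB; rewrite -ball_normE.
Qed.

Lemma closed_span_submod_closed S : submod_closed (closed_span S).
Proof.
split => [|a u v /closed_span_approx uS /closed_span_approx vS].
  apply/closed_span_approx => e e0; exists 0; last by rewrite subrr normr0.
  by exists [::] => //; rewrite big_nil.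
apply/closed_span_approx => e e0.
have d0 : 0 < e / 2 / (`|a| + 1) by rewrite !divr_gt0// ltr_wpDl.
have [u' Su' uu'] := uS _ d0.
have [v' Sv' vv'] := vS (e / 2) (divr_gt0 e0 (ltr0Sn _ _)).
exists (a *: u' + v'); first exact: lspan_lin.
rewrite opprD addrACA -scalerBr [ltRHS]splitr (le_lt_trans (ler_normD _ _))//.
rewrite ler_ltD// normrZ; move: uu'; rewrite ltr_pdivlMr ?ltr_wpDl// => uu'.
by rewrite (le_trans _ (ltW uu'))// mulrC ler_wpM2l// lerDl.
Qed.

HB.instance Definition _ S :=
  GRing.isSubmodClosed.Build _ _ (closed_span S) (closed_span_submod_closed S).

End closed_span.

(* The basepoint o is a parameter of Lip0 and LF; LF o inherits its norm and
   topology from the dual of Lip0 o. *)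
Section lipschitz_free_space.
Context {R : realType} {X : metricType R} (o : X).

Lemma evaluation_subproof (x : X) :
  (fun f : Lip0 o => f x) \in dual_pred (V := Lip0 o).
Proof.
apply/asboolP; split=> //; exists (mdist x o) => f.
by rewrite mulrC -[f x]subr0 -(Lip0_base f) lip_normP.
Qed.

Definition evaluation (x : X) : dual_space (Lip0 o) :=
  MkDual (evaluation_subproof x).

Record LF := MkLF {
  LF_val :> dual_space (Lip0 o) ;
  _ : LF_val \in closed_span (range evaluation) }.

HB.instance Definition _ := [isSub of LF for LF_val].
HB.instance Definition _ := [Choice of LF by <:].
HB.instance Definition _ := [SubChoice_isSubLmodule of LF by <:].

Definition LF_norm (m : LF) : R := `|LF_val m|.

Lemma ler_LF_normD m1 m2 : LF_norm (m1 + m2) <= LF_norm m1 + LF_norm m2.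
Proof. exact: ler_normD. Qed.

Lemma LF_normZ a m : LF_norm (a *: m) = `|a| * LF_norm m.
Proof. exact: normrZ. Qed.

Lemma LF_norm_eq0 m : LF_norm m = 0 -> m = 0.
Proof. by move=> /normr0_eq0 m0; exact/val_inj. Qed.

HB.instance Definition _ :=
  Lmodule_isNormed.Build R LF ler_LF_normD LF_normZ LF_norm_eq0.

End lipschitz_free_space.

Definition isomorphic {R : realType} (V W : normedModType R) : Prop :=
  exists (f : {linear V -> W}) (g : {linear W -> V}),
    [/\ cancel f g, cancel g f, continuous f & continuous g].

(* Main.v *)
From HB Require Import structures.
Require Import Defs.
From mathcomp Require Import all_boot all_order all_algebra.
From mathcomp Require Import all_classical all_reals all_analysis.
From mathcomp Require Import ring lra zify.
Set Implicit Arguments.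
Unset Strict Implicit.
Unset Printing Implicit Defensive.
Import Order.TTheory GRing.Theory Num.Theory.
Import numFieldNormedType.Exports.
Local Open Scope classical_set_scope.
Local Open Scope ring_scope.

(** A bounded operator from Lip_0(Y) to Lip_0(X) whose value at each point of X
    is a finite linear combination of values at points of Y induces, by
    composition, an operator from LF(X) to LF(Y), and two such operators inverse
    to each other give an isomorphism of the free spaces ([isom_LF]).  The
    theorem thus follows from explicit formulas for Lipschitz functions.

    Let Q be the space of Lipschitz functions on the cube [-1, 1]^n vanishing
    at its centre, and X the space of bounded sequences of elements of Q.  Since
    X is isomorphic to the space of bounded sequences of elements of X, the
    decomposition method of Pelczynski ([pelczynski]) shows that any space A
    such that A is complemented in X and X in A is isomorphic to bounded
    sequences of elements of X.  This is applied to A = Lip_0(R^n) and to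
    A = Lip_0(H^n), so four complementations are needed.

    For X in A, choose infinitely many disjoint cubes shrinking to the sphere
    at infinity (in the ball) or growing to infinity (in R^n), of size
    comparable to the distance to the sphere, respectively to 0.  Functions on
    the cubes are extended by cutting them off, and recovered by restriction
    ([cubes_retract_euclidean], [cubes_retract_hyperbolic]).

    For Lip_0(R^n) in X, write f as the sum of its products with a partition of
    unity over dyadic shells: on the shell of radius 2^k the equality f(0) = 0
    bounds f by a multiple of 2^k, which is what a cutoff of slope 2^-k can
    afford ([euclidean_retract_cubes]).

    For Lip_0(H^n) in X, which is the heart of the matter
    ([hyperbolic_retract_cubes]), let E_m f be the interpolation of f from a
    grid of mesh 2^-m whose nodes have been pushed away from the sphere, to depth
    at least a multiple of 2^-m, with E_0 f = f(0) = 0.  At a point x of depth about 2^-M,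
      f = (f - E_M f) + (E_M f - E_(M-1) f) + ... + (E_1 f - E_0 f).
    The first term is a sum of pieces living on cubes of the size of the depth,
    on which the hyperbolic metric is a multiple of the Euclidean one.  The
    other terms only involve differences of f between nodes at bounded
    hyperbolic distance, that is, bounded scalars.  The weights of E_m have
    Euclidean slope 2^m, hence hyperbolic slope 2^m 2^-M at x, and these slopes
    have a bounded sum over m <= M ([layer_sum_lip]): bounded data are therefore
    reassembled into a Lipschitz function.  In other words, mass flows from x to
    the origin through coarser and coarser averages, and neighbouring points
    send almost the same flow; this is how the tree-likeness of H^n is used.

    The Riemannian distance itself enters through two facts only: a segment
    bounds it from above ([hyperbolic_dist_segment]), and a function whose
    local slope is at most a multiple of 1 / depth is Lipschitz for it
    ([lipschitz_of_local]). *)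

(** * Spaces of functions and the decomposition method *)

Section finite_functionals.
Context {R : realType}.
Implicit Types S T : Type.

(** A linear combination of evaluations, with coefficients that do not depend on
    [f]: on Lipschitz functions it is an element of the free space. *)
Definition finite_comb S (L : (S -> R) -> R) : Prop :=
  exists s : seq (R * S), forall f, L f = \sum_(q <- s) q.1 * f q.2.

Lemma finite_comb_eval S (x : S) : finite_comb (fun f => f x).
Proof. by exists [:: (1, x)] => f; rewrite big_seq1 mul1r. Qed.

Lemma finite_comb0 S : finite_comb (fun _ : S -> R => 0).
Proof. by exists [::] => f; rewrite big_nil. Qed.

Lemma finite_combD S (L M : (S -> R) -> R) :
  finite_comb L -> finite_comb M -> finite_comb (fun f => L f + M f).
Proof.
by move=> [s Ls] [t Mt]; exists (s ++ t) => f; rewrite big_cat/= Ls Mt.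
Qed.

Lemma finite_combZ S (L : (S -> R) -> R) a :
  finite_comb L -> finite_comb (fun f => a * L f).
Proof.
move=> [s Ls]; exists [seq (a * q.1, q.2) | q <- s] => f.
by rewrite big_map Ls mulr_sumr; apply: eq_bigr => q _; rewrite mulrA.
Qed.

Lemma finite_combB S (L M : (S -> R) -> R) :
  finite_comb L -> finite_comb M -> finite_comb (fun f => L f - M f).
Proof.
move=> Lf Mf; have [s sE] := finite_combD Lf (finite_combZ (-1) Mf).
by exists s => f; rewrite -sE mulN1r.
Qed.

Lemma finite_comb_sum S I (r : seq I) (L : I -> (S -> R) -> R) :
  (forall i, finite_comb (L i)) -> finite_comb (fun f => \sum_(i <- r) L i f).
Proof.
move=> Lf; elim: r => [|i r IHr].
  by exists [::] => f; rewrite !big_nil.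
have [s sE] := finite_combD (Lf i) IHr.
by exists s => f; rewrite -sE big_cons.
Qed.

Lemma finite_comb_comp S T (L : (T -> R) -> R) (Phi : (S -> R) -> T -> R) :
  finite_comb L -> (forall t, finite_comb (fun f => Phi f t)) ->
  finite_comb (fun f => L (Phi f)).
Proof.
move=> [s Ls] fPhi.
have [u uE] := finite_comb_sum s (fun q => finite_combZ q.1 (fPhi q.2)).
by exists u => f; rewrite Ls uE.
Qed.

Lemma finite_comb_lin S (L : (S -> R) -> R) a f g :
  finite_comb L -> L (fun s => a * f s + g s) = a * L f + L g.
Proof.
move=> [s Ls]; rewrite !Ls mulr_sumr -big_split/=.
by apply: eq_bigr => q _; ring.
Qed.

Lemma finite_comb_addB S (L : (S -> R) -> R) f g h : finite_comb L ->
  L (fun s => f s + (g s - h s)) = L f + (L g - L h).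
Proof.
move=> [s Ls]; rewrite !Ls -sumrB -big_split/=.
by apply: eq_bigr => q _; ring.
Qed.

End finite_functionals.

Section function_spaces.
Context (R : realType).

(** A space of functions presented by its balls: [bnd K f] says that [f] belongs
    to the space with norm at most [K]; normalizations such as [f o = 0] are part
    of [bnd].  Sums and powers of such spaces are again spaces of functions, on
    disjoint unions of the underlying types, so no abstract Banach space is
    involved. *)
Record fspace := FSpace {
  pts :> Type;
  bnd : R -> (pts -> R) -> Prop;
  bnd0 : forall K, 0 <= K -> bnd K (fun=> 0);
  bndB : forall K L f g, bnd K f -> bnd L g -> bnd (K + L) (fun t => f t - g t);
  bndW : forall K L f, K <= L -> bnd K f -> bnd L f }.

Implicit Types A B C X Y : fspace.

Lemma bndD A K L f g :
  bnd K f -> bnd L g -> @bnd A (K + L) (fun t => f t + g t).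
Proof.
move=> fK gL; have := bndB fK (bndB (bnd0 A (lexx 0)) gL); rewrite add0r.
by congr (bnd _ _); apply/funext => t; rewrite sub0r opprK.
Qed.

Definition bounded A f := exists2 K : R, 0 <= K & @bnd A K f.

(** A bounded operator which is weak* continuous in a strong sense: the values of
    [Phi f] are finite combinations of values of [f].  It is linear for this
    reason, and it has a preadjoint. *)
Definition morphism A B (Phi : (A -> R) -> B -> R) : Prop :=
  (forall t, finite_comb (fun f => Phi f t)) /\
  exists2 c : R, 0 <= c &
    forall K f, 0 <= K -> bnd K f -> bnd (c * K) (Phi f).

Lemma morphism_bounded A B Phi f :
  morphism (A := A) (B := B) Phi -> bounded f -> bounded (Phi f).
Proof.
move=> [_ [c c0 cP]] [K K0 fK]; exists (c * K); first exact: mulr_ge0.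
exact: cP.
Qed.

Lemma morphism_comp A B C (Phi : (A -> R) -> B -> R) (Psi : (B -> R) -> C -> R) :
  morphism Phi -> morphism Psi -> morphism (fun f => Psi (Phi f)).
Proof.
move=> [fPhi [c c0 cP]] [fPsi [d d0 dP]]; split.
  by move=> t; apply: (finite_comb_comp (fPsi t) fPhi).
exists (d * c); first exact: mulr_ge0.
by move=> K f K0 fK; rewrite -mulrA; apply: dP; [exact: mulr_ge0|exact: cP].
Qed.

Lemma morphism_addB A B (Phi : (A -> R) -> B -> R) f g h : morphism Phi ->
  Phi (fun s => f s + (g s - h s)) =
  fun t => Phi f t + (Phi g t - Phi h t).
Proof.
by move=> [fPhi _]; apply/funext => t; exact: (finite_comb_addB _ _ _ (fPhi t)).
Qed.

Lemma morphism_id A : morphism (A := A) (B := A) (fun f => f).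
Proof.
split=> [t|]; first exact: finite_comb_eval.
by exists 1 => // K f _; rewrite mul1r.
Qed.

Lemma morphismD A B (Phi Psi : (A -> R) -> B -> R) :
  morphism Phi -> morphism Psi -> morphism (fun f t => Phi f t + Psi f t).
Proof.
move=> [fPhi [c c0 cP]] [fPsi [d d0 dP]]; split.
  by move=> t; apply: finite_combD.
exists (c + d); first exact: addr_ge0.
by move=> K f K0 fK; rewrite mulrDl; apply: bndD; [exact: cP|exact: dP].
Qed.

Lemma morphismB A B (Phi Psi : (A -> R) -> B -> R) :
  morphism Phi -> morphism Psi -> morphism (fun f t => Phi f t - Psi f t).
Proof.
move=> [fPhi [c c0 cP]] [fPsi [d d0 dP]]; split.
  by move=> t; apply: finite_combB.
exists (c + d); first exact: addr_ge0.
by move=> K f K0 fK; rewrite mulrDl; apply: bndB; [exact: cP|exact: dP].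
Qed.

(** [A] is isomorphic to a complemented subspace of [B]. *)
Definition retract A B : Prop := exists (i : (A -> R) -> B -> R) r,
  [/\ morphism i, morphism r & forall f, bounded f -> r (i f) = f].

Definition isom A B : Prop := exists (i : (A -> R) -> B -> R) r,
  [/\ morphism i, morphism r, (forall f, bounded f -> r (i f) = f)
    & forall g, bounded g -> i (r g) = g].

Lemma isom_sym A B : isom A B -> isom B A.
Proof. by move=> [i [r [mi mr ri ir]]]; exists r, i. Qed.

Lemma isom_trans B A C : isom A B -> isom B C -> isom A C.
Proof.
move=> [i [r [mi mr ri ir]]] [j [s [mj ms sj js]]].
exists (fun f => j (i f)), (fun g => r (s g)); split.
- exact: morphism_comp.
- exact: morphism_comp.
- by move=> f bf; rewrite sj ?ri//; exact: morphism_bounded mi bf.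
- by move=> g bg; rewrite ir ?js//; exact: morphism_bounded ms bg.
Qed.

Lemma retract_trans B A C : retract A B -> retract B C -> retract A C.
Proof.
move=> [i [r [mi mr ri]]] [j [s [mj ms sj]]].
exists (fun f => j (i f)), (fun g => r (s g)); split.
- exact: morphism_comp.
- exact: morphism_comp.
- by move=> f bf; rewrite sj ?ri//; exact: morphism_bounded mi bf.
Qed.

Section power.
Context (J : Type) (A : fspace).

Lemma power_bnd0 (K : R) : 0 <= K ->
  forall j : J, bnd K (fun t : A => (fun=> 0 : R) (j, t)).
Proof. by move=> K0 j; exact: bnd0. Qed.

(** The l_infinity sum of copies of [A] indexed by [J]. *)
Definition power := @FSpace (J * A) (fun K f => forall j, bnd K (fun t => f (j, t)))
  power_bnd0
  (fun K L f g fK gL j => bndB (fK j) (gL j))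
  (fun K L f KL fK j => bndW KL (fK j)).

End power.

Section direct_sum.
Context (A B : fspace).

Let sum_bnd (K : R) (f : A + B -> R) :=
  bnd K (fun t => f (inl t)) /\ bnd K (fun t => f (inr t)).

Let sum_bnd0 K : 0 <= K -> sum_bnd K (fun=> 0).
Proof. by move=> K0; split; exact: bnd0. Qed.

Let sum_bndB K L f g :
  sum_bnd K f -> sum_bnd L g -> sum_bnd (K + L) (fun t => f t - g t).
Proof.
by move=> [fA fB] [gA gB]; split; [exact: (bndB fA gA)|exact: (bndB fB gB)].
Qed.

Let sum_bndW K L f : K <= L -> sum_bnd K f -> sum_bnd L f.
Proof. by move=> KL [fA fB]; split; [exact: bndW fA|exact: bndW fB]. Qed.

Definition direct_sum := FSpace sum_bnd0 sum_bndB sum_bndW.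

End direct_sum.

Lemma morphism_inl A B :
  morphism (A := direct_sum A B) (B := A) (fun f t => f (inl t)).
Proof.
split=> [t|]; first exact: finite_comb_eval.
by exists 1 => // K f _ [+ _]; rewrite mul1r.
Qed.

Lemma morphism_inr A B :
  morphism (A := direct_sum A B) (B := B) (fun f t => f (inr t)).
Proof.
split=> [t|]; first exact: finite_comb_eval.
by exists 1 => // K f _ [_]; rewrite mul1r.
Qed.

Definition copair (A B : Type) (f : A -> R) (g : B -> R) (t : A + B) : R :=
  match t with inl a => f a | inr b => g b end.

Lemma morphism_copair A B C (Phi : (C -> R) -> A -> R) (Psi : (C -> R) -> B -> R) :
  morphism Phi -> morphism Psi ->
  morphism (A := C) (B := direct_sum A B) (fun f => copair (Phi f) (Psi f)).
Proof.
move=> [fPhi [c c0 cP]] [fPsi [d d0 dP]]; split; first by case.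
exists (c + d) => [|K f K0 fK]; first exact: addr_ge0.
have cK : 0 <= c * K by exact: mulr_ge0.
have dK : 0 <= d * K by exact: mulr_ge0.
split.
  by apply: (bndW _ (cP _ _ K0 fK)); rewrite mulrDl lerDl.
by apply: (bndW _ (dP _ _ K0 fK)); rewrite mulrDl lerDr.
Qed.

Lemma morphism_coord J A (j : J) :
  morphism (A := power J A) (B := A) (fun f t => f (j, t)).
Proof.
split=> [t|]; first exact: finite_comb_eval.
by exists 1 => // K f _ fK; rewrite mul1r; exact: fK.
Qed.

Lemma morphism_power J A B (c : R) (Phi : J -> (A -> R) -> B -> R) : 0 <= c ->
  (forall j t, finite_comb (fun f => Phi j f t)) ->
  (forall j K f, 0 <= K -> bnd K f -> bnd (c * K) (Phi j f)) ->
  morphism (A := A) (B := power J B) (fun f jt => Phi jt.1 f jt.2).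
Proof.
by move=> c0 fPhi cP; split=> [[]|]//; exists c => // K f K0 fK j; exact: cP.
Qed.

(** With P the projection of [X] on a copy of [A], the extra summand [A] is
    pushed into the P-part of coordinate 0, the P-part of coordinate n into the
    one of coordinate n + 1, while the complementary parts stay in place. *)
Lemma shift_isom A X : retract A X -> 
  isom (direct_sum A (power nat X)) (power nat X).
Proof.
move=> [i [r [mi mr ri]]].
pose P f := i (r f); have mP : morphism P by exact: morphism_comp mi.
pose Q f t : R := f t - P f t.
have mQ : morphism Q by apply: morphismB mP; exact: morphism_id.
have [fi [ci ci0 iP]] := mi; have [fr [cr cr0 rP]] := mr.
have [fP [cP cP0 PP]] := mP; have [fQ [cQ cQ0 QP]] := mQ.
pose V := direct_sum A (power nat X).
pose x (F : V -> R) n t : R := F (inr (n, t)).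
pose Phi (F : V -> R) (nt : nat * X) : R :=
  (if nt.1 is n.+1 then P (x F n) nt.2 else i (fun a => F (inl a)) nt.2) +
  Q (x F nt.1) nt.2.
pose y (G : power nat X -> R) n t : R := G (n, t).
pose Psi (G : power nat X -> R) : V -> R :=
  copair (r (y G 0%N)) (fun nt : nat * X => P (y G nt.1.+1) nt.2 + Q (y G nt.1) nt.2).
have mPhi : morphism (A := V) (B := power nat X) Phi.
  have mx n : morphism (A := V) (B := X) (fun F => x F n).
    exact: (morphism_comp (morphism_inr A (power nat X)) (morphism_coord X n)).
  split=> [[n t]|]; rewrite /Phi/=.
    apply: finite_combD; last first.
      by have [] := morphism_comp (mx n) mQ.
    case: n => [|n]; last by have [] := morphism_comp (mx n) mP.
    by have [] := morphism_comp (morphism_inl A (power nat X)) mi.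
  exists (ci + cP + cQ) => [|K F K0 [FA FX] n]; first by rewrite !addr_ge0.
  rewrite mulrDl; apply: bndD; last exact/QP/FX.
  have ciK : 0 <= ci * K by exact: mulr_ge0.
  have cPK : 0 <= cP * K by exact: mulr_ge0.
  case: n => [|n]/=.
    by apply: (bndW _ (iP _ _ K0 FA)); rewrite mulrDl lerDl.
  by apply: (bndW _ (PP _ _ K0 (FX n))); rewrite mulrDl lerDr.
have mPsi : morphism (A := power nat X) (B := V) Psi.
  apply: morphism_copair; first exact: morphism_comp (morphism_coord _ _) mr.
  apply: (@morphism_power _ _ _ (cP + cQ)
    (fun n G t => P (y G n.+1) t + Q (y G n) t)).
  - exact: addr_ge0.
  - move=> n t; apply: finite_combD.
      by have [] := morphism_comp (morphism_coord X n.+1) mP.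
    by have [] := morphism_comp (morphism_coord X n) mQ.
  - move=> n K G K0 GK; rewrite mulrDl; apply: bndD; first exact/PP/GK.
    exact/QP/GK.
have rP' f : bounded f -> r (P f) = r f.
  by move=> bf; rewrite /P ri//; exact: morphism_bounded bf.
have PPP f : bounded f -> P (P f) = P f by move=> bf; rewrite {1}/P rP'.
exists Phi, Psi; split=> // [F [K K0 [FA FX]]|G [K K0 GK]].
  have bF n : bounded (x F n) by exists K => //; exact: FX.
  have bFA : bounded (fun a => F (inl a)) by exists K.
  apply/funext => -[a|[n t]]; rewrite /Psi /y /Phi /Q/=.
    by rewrite morphism_addB// ri// rP'// subrr addr0.
  rewrite !(morphism_addB _ _ _ mP) !PPP// subrr addr0.
  case: n => [|n]; last by rewrite PPP// /x; ring.
  have -> : P (i (fun a => F (inl a))) = i (fun a => F (inl a)).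
    by rewrite /P ri.
  by rewrite /x; ring.
have bG n : bounded (y G n) by exists K => //; exact: GK.
apply/funext => -[n t]; rewrite /Phi /Psi /x /Q/=.
rewrite !(morphism_addB _ _ _ mP) !PPP// subrr addr0.
case: n => [|n]; last by rewrite (morphism_addB _ _ _ mP) !PPP// /y; ring.
by rewrite -/(P _) /y; ring.
Qed.

(** The copy of [Y] inside [A] makes room for a second one, through the
    isomorphism of [Y + Y] with [Y]; the complement of [Y] in [A] is untouched. *)
Lemma absorb_isom A Y : isom (direct_sum Y Y) Y -> retract Y A ->
  isom (direct_sum A Y) A.
Proof.
move=> [m [u [mm mu um mum]]] [i [r [mi mr ri]]].
pose V := direct_sum A Y.
have mfst := morphism_inl A Y; have msnd := morphism_inr A Y.
have mc : morphism (A := V) (B := direct_sum Y Y)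
    (fun F => copair (r (fun a => F (inl a))) (fun y => F (inr y))).
  by apply: morphism_copair => //; exact: morphism_comp mr.
have mir : morphism (fun f => i (r f)) by exact: morphism_comp mi.
pose Phi (F : V -> R) (a : A) : R :=
  i (m (copair (r (fun a => F (inl a))) (fun y => F (inr y)))) a +
  (F (inl a) - i (r (fun a => F (inl a))) a).
pose Psi (h : A -> R) : V -> R := copair
  (fun a => i (fun y => u (r h) (inl y)) a + (h a - i (r h) a))
  (fun y => u (r h) (inr y)).
have mPhi : morphism (A := V) (B := A) Phi.
  apply: morphismD; first exact: morphism_comp (morphism_comp mc mm) mi.
  by apply: morphismB => //; exact: morphism_comp mir.
have mur := morphism_comp mr mu.
have mPsi : morphism (A := A) (B := V) Psi.
  apply: morphism_copair; last exact: (morphism_comp mur (morphism_inr Y Y)).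
  apply: morphismD; last by apply: morphismB => //; exact: morphism_id.
  exact: (morphism_comp (morphism_comp mur (morphism_inl Y Y)) mi).
have [fr _] := mr; have [fi _] := mi.
exists Phi, Psi; split=> // [F bF|h bh].
  have bf : bounded (fun a => F (inl a)) by exact: (morphism_bounded mfst bF).
  have brf := morphism_bounded mr bf.
  have bc := morphism_bounded mc bF.
  have rPhi : r (Phi F) =
      m (copair (r (fun a => F (inl a))) (fun y => F (inr y))).
    rewrite /Phi morphism_addB//; apply/funext => y.
    by rewrite !ri ?subrr ?addr0//; exact: morphism_bounded bc.
  apply/funext => -[a|y]; rewrite /Psi/= rPhi um// /Phi/=.
  set p := i [eta _] a.
  by ring.
have brh := morphism_bounded mr bh.
have burh := morphism_bounded mu brh.
have b1 : bounded (fun y => u (r h) (inl y)).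
  exact: (morphism_bounded (morphism_inl Y Y) burh).
have rPsi : r (fun a => Psi h (inl a)) = fun y => u (r h) (inl y).
  rewrite /Psi/= morphism_addB//; apply/funext => y.
  by rewrite !ri ?subrr ?addr0.
apply/funext => a; rewrite /Phi rPsi.
have -> : copair (fun y : Y => u (r h) (inl y)) (fun y => Psi h (inr y)) = u (r h).
  by apply/funext => -[].
by rewrite mum// /Psi/=; ring.
Qed.

Lemma power_reindex J K A (h : J -> K) (k : K -> option J) :
  pcancel h k -> retract (power J A) (power K A).
Proof.
move=> hk.
pose i (f : power J A -> R) (kt : K * A) : R :=
  if k kt.1 is Some j then f (j, kt.2) else 0.
exists i, (fun g jt => g (h jt.1, jt.2)); split.
- apply: (@morphism_power _ _ _ 1
    (fun j (f : power J A -> R) t => if k j is Some j' then f (j', t) else 0)) => //.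
    move=> j t; case: (k j) => [j'|]; last exact: finite_comb0.
    exact: finite_comb_eval.
  move=> j L f L0 fL; rewrite mul1r; case: (k j) => [j'|]; last exact: bnd0.
  exact: fL.
- apply: (@morphism_power _ _ _ 1 (fun j (f : power K A -> R) t => f (h j, t))) => //.
    by move=> j t; exact: finite_comb_eval.
  by move=> j L f L0 fL; rewrite mul1r; exact: fL.
- by move=> f bf; apply/funext => -[j t]; rewrite /i/= hk.
Qed.

Lemma power_power_retract (J K : countType) A :
  retract (power J (power K A)) (power nat A).
Proof.
apply: (@retract_trans (power (J * K) A)); last first.
  exact: power_reindex (@pickleK _).
exists (fun f jkt => f (jkt.1.1, (jkt.1.2, jkt.2))),
  (fun g jkt => g ((jkt.1, jkt.2.1), jkt.2.2)); split.
- split=> [[[j k] t]|]; first exact: finite_comb_eval.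
  by exists 1 => // L f L0 fL [j k]; rewrite mul1r; exact: (fL j k).
- split=> [[j [k t]]|]; first exact: finite_comb_eval.
  by exists 1 => // L f L0 fL j k; rewrite mul1r; exact: (fL (j, k)).
- by move=> f bf; apply/funext => -[j [k t]].
Qed.

Lemma power_double A : isom (direct_sum (power nat A) (power nat A)) (power nat A).
Proof.
pose V := direct_sum (power nat A) (power nat A).
exists (fun (f : V -> R) nt =>
    if odd nt.1 then f (inr (nt.1./2, nt.2)) else f (inl (nt.1./2, nt.2))),
  (fun g => copair (fun nt : nat * A => g (nt.1.*2, nt.2))
                   (fun nt : nat * A => g (nt.1.*2.+1, nt.2))).
split.
- split=> [[n t]|]/=; first by case: odd; exact: finite_comb_eval.
  exists 1 => // K f K0 [f1 f2] n; rewrite mul1r/=.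
  by case: odd; [exact: f2|exact: f1].
- split=> [[[n t]|[n t]]|]; try exact: finite_comb_eval.
  exists 1 => // K f K0 fK; rewrite mul1r; split=> n; first exact: (fK n.*2).
  exact: (fK n.*2.+1).
- move=> f bf; apply/funext => -[[n t]|[n t]]/=.
    by rewrite odd_double doubleK.
  by rewrite odd_double/= uphalf_double.
- move=> g bg; apply/funext => -[n t]/=.
  by rewrite -{4}(odd_double_half n); case: odd.
Qed.

(** With Y the power of the power of [B], A = A + Y by [absorb_isom] and
    A + Y = Y by [shift_isom], up to isomorphism. *)
Lemma pelczynski A B : retract A (power nat B) -> retract (power nat B) A ->
  isom A (power nat (power nat B)).
Proof.
move=> AX XA.
have YA : retract (power nat (power nat B)) A.
  exact: retract_trans (power_power_retract _ _ _) XA.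
apply: isom_trans (shift_isom AX).
exact/isom_sym/absorb_isom/YA/power_double.
Qed.

End function_spaces.

Arguments bnd {R A} K f : rename.

(** * From spaces of Lipschitz functions to free spaces *)

Section free_space_functor.
Context {R : realType}.

Section lipschitz_space.
Context (X : metricType R) (o : X).

Let lip_bnd (K : R) (f : X -> R) :=
  f o = 0 /\ forall x y, `|f x - f y| <= K * mdist x y.

Let lip_bnd0 K : 0 <= K -> lip_bnd K (fun=> 0).
Proof.
by move=> K0; split=> // x y; rewrite subrr normr0 mulr_ge0// mdist_ge0.
Qed.

Let lip_bndB K L f g :
  lip_bnd K f -> lip_bnd L g -> lip_bnd (K + L) (fun t => f t - g t).
Proof.
move=> [fo fK] [go gL]; split=> [|x y]; first by rewrite fo go subrr.
rewrite opprD addrACA -opprD (le_trans (ler_normB _ _))// mulrDl.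
by rewrite lerD.
Qed.

Let lip_bndW K L f : K <= L -> lip_bnd K f -> lip_bnd L f.
Proof.
move=> KL [fo fK]; split=> // x y; apply: le_trans (fK x y) _.
by rewrite ler_wpM2r// mdist_ge0.
Qed.

Definition lip_space := FSpace lip_bnd0 lip_bndB lip_bndW.

Lemma lip_space_Lip0 (f : Lip0 o) : bnd (A := lip_space) `|f| f.
Proof. by split; [exact: Lip0_base|move=> x y; exact: lip_normP]. Qed.

Lemma Lip0_bounded_fun (f : Lip0 o) : bounded (A := lip_space) f.
Proof. by exists `|f|; [exact: normr_ge0|exact: lip_space_Lip0]. Qed.

Lemma lip0_pred_bnd K f : bnd (A := lip_space) K f -> f \in lip0_pred o.
Proof. by move=> [fo fK]; apply/asboolP; split=> //; exists K. Qed.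

Lemma Lip0_norm_le K (f : Lip0 o) : 0 <= K -> bnd (A := lip_space) K f -> `|f| <= K.
Proof. by move=> K0 [_ fK]; apply: least_bound_le => // -[x y]; exact: fK. Qed.

End lipschitz_space.

Lemma linear_bounded_continuous_le (V W : normedModType R) (f : {linear V -> W}) c :
  (forall v, `|f v| <= c * `|v|) -> continuous f.
Proof.
move=> fc; apply/linear_bounded_continuous/linear_boundedP.
exists c; split=> [|r cr v]; first exact: num_real.
by apply: (le_trans (fc v)); rewrite ler_wpM2r// ltW.
Qed.

Section pushforward.
Context (X Y : metricType R) (o : X) (p : Y).
Context (Phi : (Y -> R) -> X -> R).
Hypothesis mPhi : morphism (A := lip_space p) (B := lip_space o) Phi.

Let Phi_Lip0_subproof (g : Lip0 p) : Phi g \in lip0_pred o.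
Proof.
have [K _ gK] := morphism_bounded mPhi (Lip0_bounded_fun g).
exact: lip0_pred_bnd gK.
Qed.

Definition pullback (g : Lip0 p) : Lip0 o := MkLip0 (Phi_Lip0_subproof g).

Lemma pullback_linear : linear pullback.
Proof.
move=> a g h; apply/val_inj/funext => x /=.
have [fPhi _] := mPhi; exact: (finite_comb_lin a g h (fPhi x)).
Qed.

Lemma pullback_norm : exists2 c, 0 <= c & forall g, `|pullback g| <= c * `|g|.
Proof.
have [_ [c c0 cP]] := mPhi; exists c => // g; apply: Lip0_norm_le.
  by rewrite mulr_ge0.
by apply: cP => //; exact: lip_space_Lip0.
Qed.

Let dual_subproof (m : dual_space (Lip0 o)) :
  (fun g => m (pullback g)) \in dual_pred (V := Lip0 p).
Proof.
apply/asboolP; split.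
  by move=> a g h; rewrite pullback_linear dual_scalar.
have [c c0 cP] := pullback_norm; have [K K0 mK] :=
  bounded_by_nneg (@normr_ge0 _ _) (dual_bounded m).
exists (K * c) => g; apply: (le_trans (mK _)).
by rewrite -mulrA ler_wpM2l.
Qed.

(** The adjoint of [pullback]; it maps free space to free space because it maps
    evaluations to finite combinations of evaluations. *)
Definition dual_push (m : dual_space (Lip0 o)) : dual_space (Lip0 p) :=
  MkDual (dual_subproof m).

Lemma dual_push_linear : linear dual_push.
Proof. by move=> a m k; apply/val_inj. Qed.

Lemma dual_push_norm : exists2 c, 0 <= c & forall m, `|dual_push m| <= c * `|m|.
Proof.
have [c c0 cP] := pullback_norm; exists c => // m.
apply: least_bound_le => [|g]; first by rewrite mulr_ge0.
apply: (le_trans (least_boundP (@normr_ge0 _ _) (pullback g) (dual_bounded m))).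
by rewrite mulrAC [X in _ <= X]mulrC ler_wpM2l// least_bound_ge0.
Qed.

Lemma dual_push_evaluation x :
  lspan (range (@evaluation R Y p)) (dual_push (evaluation o x)).
Proof.
have [fPhi _] := mPhi; have [s sE] := fPhi x.
exists [seq (q.1, evaluation p q.2) | q <- s].
  by move=> _ /mapP[q qs ->]; exists q.2.
apply/val_inj/funext => g /=; rewrite sE big_map.
elim: s {sE} => [|q s IHs]; first by rewrite !big_nil.
by rewrite !big_cons IHs.
Qed.

Lemma dual_push_lspan m : lspan (range (@evaluation R X o)) m ->
  lspan (range (@evaluation R Y p)) (dual_push m).
Proof.
move=> [s sX ->]; elim: s sX => [|q s IHs] sX.
  exists [::] => //; rewrite !big_nil.
  by apply/val_inj.
rewrite big_cons dual_push_linear; apply: lspan_lin.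
  have [x _ <-] := sX q (mem_head _ _); exact: dual_push_evaluation.
by apply: IHs => r rs; apply: sX; rewrite in_cons rs orbT.
Qed.

Let LF_subproof (m : LF o) :
  dual_push m \in closed_span (range (@evaluation R Y p)).
Proof.
have [c c0 cP] := dual_push_norm.
case: m => m /= /closed_span_approx mS; apply/closed_span_approx => e e0.
have d0 : 0 < e / (c + 1) by rewrite divr_gt0// ltr_wpDl.
have [w wS mw] := mS _ d0; exists (dual_push w); first exact: dual_push_lspan.
have -> : dual_push m - dual_push w = dual_push (m - w) by apply/val_inj.
apply: (le_lt_trans (cP _)); move: mw; rewrite ltr_pdivlMr ?ltr_wpDl//.
by apply: le_lt_trans; rewrite mulrC ler_wpM2l// lerDl.
Qed.

Definition LF_push (m : LF o) : LF p := MkLF (LF_subproof m).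

Lemma LF_push_linear : linear LF_push.
Proof. by move=> a m k; apply/val_inj/val_inj. Qed.

Lemma LF_push_norm : exists c, forall m, `|LF_push m| <= c * `|m|.
Proof. by have [c _ cP] := dual_push_norm; exists c => m; exact: cP. Qed.

End pushforward.

Lemma isom_LF (X Y : metricType R) (o : X) (p : Y) :
  isom (lip_space o) (lip_space p) -> isomorphic (LF o) (LF p).
Proof.
move=> [i [r [mi mr ri ir]]].
pose f := LF_push mr; pose g := LF_push mi.
pose fL := GRing.isLinear.Build _ _ _ _ f (LF_push_linear mr).
pose gL := GRing.isLinear.Build _ _ _ _ g (LF_push_linear mi).
pose F : {linear LF o -> LF p} := HB.pack f fL.
pose G : {linear LF p -> LF o} := HB.pack g gL.
exists F, G; split.
- move=> m; apply/val_inj/val_inj/funext => h /=; congr (m _); apply/val_inj => /=.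
  exact/ri/Lip0_bounded_fun.
- move=> m; apply/val_inj/val_inj/funext => h /=; congr (m _); apply/val_inj => /=.
  exact/ir/Lip0_bounded_fun.
- have [c cP] := LF_push_norm mr.
  exact: (linear_bounded_continuous_le (f := F) cP).
- have [c cP] := LF_push_norm mi.
  exact: (linear_bounded_continuous_le (f := G) cP).
Qed.

(** Subtracting a constant changes the point where functions vanish. *)
Lemma lip_space_base (X : metricType R) (o p : X) :
  isom (lip_space o) (lip_space p).
Proof.
suff base (a b : X) : morphism (A := lip_space a) (B := lip_space b)
    (fun f x => f x - f b).
  exists (fun f x => f x - f p), (fun f x => f x - f o); split=> //.
    by move=> f [K _ [fo _]]; apply/funext => x; rewrite fo; ring.
  by move=> f [K _ [fo _]]; apply/funext => x; rewrite fo; ring.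
split=> [x|]; first exact: finite_combB (finite_comb_eval _) (finite_comb_eval _).
exists 1 => // K f K0 [_ fK]; split=> [|x y]; first by rewrite subrr.
by rewrite mul1r opprB addrA subrK.
Qed.

End free_space_functor.

(** * The hyperbolic distance in the ball *)

Section cousin.
Context {R : realType}.

(** Cousin's lemma: a property of intervals which is additive, and true for all
    small intervals around each point, holds for the whole of [0, 1].  The proof
    shows that 1 is the supremum of the t such that it holds for [0, t]. *)
Lemma cousin (P : R -> R -> Prop) :
  (forall a m b, 0 <= a -> a <= m -> m <= b -> b <= 1 ->
    P a m -> P m b -> P a b) ->
  (forall t, 0 <= t <= 1 -> exists2 e, 0 < e & forall a b, 0 <= a -> a <= t ->
    t <= b -> b <= 1 -> b - a < e -> P a b) ->
  P 0 1.
Proof.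
move=> Pcat Ploc.
pose S := [set t | 0 <= t <= 1 /\ P 0 t].
have S0 : S 0.
  split; first by rewrite lexx ler01.
  by have [|e e0 Pe] := Ploc 0; [rewrite lexx ler01|apply: Pe; rewrite ?subrr].
have S1 : has_sup S by split; [exists 0|exists 1 => t [/andP[]]].
have s0 : 0 <= sup S by apply: ub_le_sup => //; exact: S1.2.
have s1 : sup S <= 1 by apply: ge_sup => [|t [/andP[]]//]; exists 0.
have [|e e0 Pe] := Ploc (sup S); first by rewrite s0.
have [t [/andP[t0 t1] Pt] lt_t] := sup_adherent (divr_gt0 e0 (ltr0Sn R 1)) S1.
have ts : t <= sup S.
  by apply: ub_le_sup; [exact: S1.2|split=> //; rewrite t0].
have [b sb [b1 bs]] : exists2 b, sup S <= b <= 1 &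
    b - sup S < e / 2 /\ (b <= sup S -> b = 1).
  have [le1|gt1] := leP 1 (sup S + e / 4).
    by exists 1; [rewrite s1 lexx|split=> //; lra].
  exists (sup S + e / 4); first by apply/andP; split; lra.
  by split=> [|]; lra.
case/andP: sb => sb b1'.
have Ptb : P t b by apply: Pe => //; lra.
have P0b : P 0 b by apply: (Pcat 0 t b) => //; lra.
have Sb : S b by split=> //; apply/andP; split=> //; lra.
have b_le : b <= sup S by apply: ub_le_sup => //; exact: S1.2.
by move: P0b; rewrite (bs b_le).
Qed.

End cousin.

Section norms.
Context {R : realType} {n : nat}.
Implicit Types u v : 'rV[R]_n.

Lemma coord_le_norm v i : `|v 0 i| <= `|v|.
Proof. by rewrite [leRHS]/Num.Def.normr/= mx_normrE; apply: (le_bigmax _ _ (0, i)). Qed.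

Lemma norm_le v c : 0 <= c -> (forall i, `|v 0 i| <= c) -> `|v| <= c.
Proof.
move=> c0 vc; rewrite [leLHS]/Num.Def.normr/= mx_normrE.
by apply: bigmax_le => //= -[i j] _; rewrite ord1; exact: vc.
Qed.

Lemma norm_le_enorm v : `|v| <= enorm v.
Proof. by apply: norm_le => [|i]; [exact: enorm_ge0|exact: coord_le_enorm]. Qed.

Lemma enorm_delta i : enorm (delta_mx 0 i : 'rV[R]_n) = 1.
Proof.
rewrite /enorm (bigD1 i)//= big1 => [|j ji]; last first.
  by rewrite mxE eqxx/= (negbTE ji) expr0n.
by rewrite mxE !eqxx expr1n addr0 sqrtr1.
Qed.

Lemma enorm_le_sum v : enorm v <= \sum_i `|v 0 i|.
Proof.
rewrite [in leLHS](row_sum_delta v); elim/big_ind2: _ => [|x a y b xa yb|i _].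
- by rewrite enorm0.
- by rewrite (le_trans (ler_enormD _ _))// lerD.
- by rewrite enormZ enorm_delta mulr1.
Qed.

Lemma enorm_le_norm v : enorm v <= n%:R * `|v|.
Proof.
apply: (le_trans (enorm_le_sum v)).
have -> : n%:R * `|v| = \sum_(i < n) `|v|.
  by rewrite sumr_const card_ord mulr_natl.
by apply: ler_sum => i _; exact: coord_le_norm.
Qed.

Lemma enorm_distrC u v : enorm (u - v) = enorm (v - u).
Proof. by rewrite -enormN opprB. Qed.

(** Comparable to the inverse of the conformal factor of the Poincare ball. *)
Definition depth v : R := 1 - enorm v.

Lemma depth_lip u v : `|depth u - depth v| <= enorm (u - v).
Proof.
rewrite /depth opprB addrC addrA subrK.
have uv := ler_enormD (u - v) v; have vu := ler_enormD (v - u) u.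
rewrite !subrK in uv vu; rewrite ler_norml; apply/andP; split.
  by move: uv vu; rewrite (enorm_distrC v u); lra.
by move: uv vu; rewrite (enorm_distrC v u); lra.
Qed.

End norms.

Section hyperbolic_geometry.
Context {R : realType} {n : nat}.
Implicit Types (x y : hyperbolic R n) (f : hyperbolic R n -> R) (c : R -> 'rV[R]_n).
Local Notation mu := (@lebesgue_measure R).

Local Notation pos := (@hyperbolic_val R n).

Lemma depth_gt0 x : 0 < depth x.
Proof. by case: x => v v1; rewrite subr_gt0. Qed.

(** The depth is concave, so it is at least [t] all along the segment, where the
    speed is then at most [2 * enorm (x - y) / t]. *)
Lemma hyperbolic_dist_segment x y t : 0 < t -> t <= depth x -> t <= depth y ->
  mdist x y <= 2 * enorm (pos x - pos y) / t.
Proof.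
move=> t0 tx ty; rewrite -[mdist x y]/(hyperbolic_dist x y).
have xyc := segment_arc x y.
apply: (le_trans (hyperbolic_dist_le (path_cons xyc (path_nil y)))).
rewrite addr0; set M := _ / t.
have -> : M = \int[mu]_(_ in `[0%R, 1%R]) M.
  by rewrite Rintegral_cst//= lebesgue_measure_itv/= lte01 oppr0 adde0 mulr1.
rewrite /hyperbolic_length; apply: le_Rintegral => //.
- exact: speed_integrable xyc.
- apply: continuous_compact_integrable; first exact: segment_compact.
  by apply: continuous_subspaceT => ?; exact: cvg_cst.
move=> s /=; rewrite in_itv/= => /andP[s0 s1].
have ds : derive1 (segment x y) s = pos y - pos x.
  have [ds _ _ _ _] := xyc.
  apply/rowP => i; have := is_derive_coord i (ds s).
  have d2 : is_derive s 1 (fun r => segment x y r 0 i) ((pos y - pos x) 0 i).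
    rewrite /segment; under eq_fun do rewrite !mxE.
    rewrite !mxE.
    by apply: is_derive_eq; rewrite add0r mul1r scaler0 add0r scaler1.
  by move=> d1; rewrite -(@derive_val _ _ _ _ _ _ _ d1) (@derive_val _ _ _ _ _ _ _ d2).
rewrite /hyperbolic_speed ds (enorm_distrC (pos y)).
have e1 : enorm (segment x y s) <= 1 - t.
  have -> : segment x y s = (1 - s) *: (x : 'rV[R]_n) + s *: (y : 'rV[R]_n).
    by rewrite /segment scalerBr scalerBl scale1r addrCA addrC.
  apply: (le_trans (ler_enormD _ _)); rewrite !enormZ !ger0_norm ?subr_ge0//.
  by move: tx ty; rewrite /depth => tx ty; nra.
have e0 := enorm_ge0 (segment x y s).
have et : t <= 1 - enorm (segment x y s) ^+ 2 by nra.
have v0 := enorm_ge0 (pos x - pos y).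
rewrite /M ler_wpM2l ?mulr_ge0// lef_pV2// posrE//.
exact: lt_le_trans et.
Qed.

Definition to_ball x (v : 'rV[R]_n) : hyperbolic R n := insubd x v.

Lemma to_ballK x v : enorm v < 1 -> pos (to_ball x v) = v.
Proof. by move=> v1; rewrite /to_ball -[LHS]/(val _) val_insubd v1. Qed.

Section arc.
Context x y c (xyc : C1_arc x y c).

Lemma arc_integrable_speed a b : 0 <= a -> b <= 1 ->
  mu.-integrable `[a, b] (EFin \o hyperbolic_speed c).
Proof.
move=> a0 b1; apply: integrableS (speed_integrable xyc) => //.
by apply: subset_itv; rewrite bnd_simp.
Qed.

Lemma arc_speed_cat a m b : 0 <= a -> a <= m -> m <= b -> b <= 1 ->
  \int[mu]_(t in `[a, b]) hyperbolic_speed c t =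
  \int[mu]_(t in `[a, m]) hyperbolic_speed c t +
  \int[mu]_(t in `[m, b]) hyperbolic_speed c t.
Proof.
move=> a0 am mb b1; have iab := arc_integrable_speed a0 b1.
have imb := arc_integrable_speed (le_trans a0 am) b1.
rewrite -(Rintegral_itv_obnd_cbnd (r := m) (b := BRight b)); last first.
  by apply: integrableS imb => //; apply: subset_itvr; rewrite bnd_simp.
rewrite -(Rintegral_itvB (a := BLeft a) (b := BRight b) (x := m) iab);
  [by ring|by rewrite bnd_simp|by rewrite bnd_simp].
Qed.

(** The fundamental theorem of calculus, coordinate by coordinate. *)
Lemma arc_coord_le a b i : 0 <= a -> a <= b -> b <= 1 ->
  `|c b 0 i - c a 0 i| <= \int[mu]_(t in `[a, b]) enorm (derive1 c t).
Proof.
move=> a0; rewrite le_eqVlt => /predU1P[<- _|ab b1].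
  rewrite subrr normr0; apply: Rintegral_ge0 => t _; exact: enorm_ge0.
have [dc cc cB c0 c1] := xyc.
pose f (t : R) : R := derive1 c t 0 i; pose F (t : R) : R := c t 0 i.
have cf : continuous f.
  move=> t; apply: (@continuous_comp _ _ _ (derive1 c)
    (fun v : 'rV[R]_n => v 0 i)); first exact: cc.
  exact: coord_continuous.
have dF (t : R) : is_derive t 1 F (f t) by exact: is_derive_coord.
have cF : continuous F.
  move=> t; apply: differentiable_continuous; apply/derivable1_diffP.
  exact: ex_derive.
have fint : mu.-integrable `[a, b] (EFin \o f).
  apply: continuous_compact_integrable; first exact: segment_compact.
  exact: continuous_subspaceT.
have -> : c b 0 i - c a 0 i = \int[mu]_(t in `[a, b]) f t.
  rewrite /Rintegral (@continuous_FTC2 _ f F)//.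
  - exact: continuous_subspaceT.
  - split=> [t _||]; first exact: ex_derive.
      exact/cvg_at_right_filter/cF.
    exact/cvg_at_left_filter/cF.
  - by move=> t _; rewrite derive1E derive_val.
apply: (le_trans (le_normr_Rintegral _ fint)) => //.
apply: le_Rintegral => //.
- exact: (integrable_norm fint).
- apply: continuous_compact_integrable; first exact: segment_compact.
  apply: continuous_subspaceT => t.
  by apply: (@continuous_comp _ _ _ (derive1 c) enorm);
    [exact: cc|exact: enorm_continuous].
- by move=> t _; exact: coord_le_enorm.
Qed.

End arc.

(** On a small interval [a, b] around t the depth along an arc is nearly constant,
    so that the local hypothesis bounds the variation of [f] by the integral of
    the speed; [cousin] then gives the bound along the whole arc.  The factor [n]
    comes from estimating the Euclidean norm by the sum of the coordinates. *)
Lemma lipschitz_of_local f K : 0 <= K ->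
  (forall x y, enorm (pos x - pos y) <= depth x / 2 ->
    `|f x - f y| <= K * (enorm (pos x - pos y) / depth x)) ->
  forall x y, `|f x - f y| <= 4 * n%:R * K * mdist x y.
Proof.
move=> K0 floc x y; set C := 4 * n%:R * K.
have C0 : 0 <= C by rewrite !mulr_ge0.
suff arcP u v c : C1_arc u v c -> `|f u - f v| <= C * hyperbolic_length c.
  have pathP l : path_length x y l -> `|f x - f y| <= C * l.
    elim=> [u|u v w c k uvc _ IH]; first by rewrite subrr normr0 mulr0.
    rewrite mulrDr (le_trans (ler_distD (f v) _ _))// lerD//.
    exact: arcP.
  have [C_eq0|C_neq0] := eqVneq C 0.
    have := pathP _ (path_cons (segment_arc x y) (path_nil y)).
    by rewrite C_eq0 !mul0r.
  have Cp : 0 < C by rewrite lt_neqAle eq_sym C_neq0.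
  rewrite mulrC -ler_pdivrMr//; apply: lb_le_inf.
    by eexists; exact: path_cons (segment_arc x y) (path_nil _).
  by move=> l xyl; rewrite ler_pdivrMr// mulrC; exact: pathP.
move=> uvc; have [dc cc cB c0 c1] := uvc.
have cont_c : continuous c.
  by move=> t; apply/differentiable_continuous/derivable1_diffP.
pose G t := f (to_ball u (c t)).
pose I a b := \int[mu]_(t in `[a, b]) hyperbolic_speed c t.
have cG t : 0 <= t <= 1 -> pos (to_ball u (c t)) = c t.
  by move=> t01; rewrite to_ballK//; exact: cB.
have -> : f u = G 0.
  by rewrite /G; congr f; apply/val_inj; rewrite /= cG ?c0// lexx ler01.
have -> : f v = G 1.
  by rewrite /G; congr f; apply/val_inj; rewrite /= cG ?c1// lexx ler01.
apply: (cousin (P := fun a b => `|G a - G b| <= C * I a b)).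
  move=> a m b a0 am mb b1 Pam Pmb; rewrite /I (arc_speed_cat uvc a0 am mb b1).
  by rewrite mulrDr (le_trans (ler_distD (G m) _ _))// lerD.
move=> t t01; pose d := depth (c t).
have d0 : 0 < d by rewrite subr_gt0 cB.
have d8 : 0 < d / 8 by rewrite divr_gt0.
have : \forall s \near t, enorm (c s - c t) < d / 8.
  have cet : (fun s => enorm (c s - c t)) @ t --> enorm (c t - c t).
    apply: (@continuous_comp _ _ _ (fun s => c s - c t) enorm).
      by apply: cvgB; [exact: cont_c|exact: cvg_cst].
    exact: enorm_continuous.
  by move/cvgr_lt: cet => /(_ (d / 8)); rewrite subrr enorm0; apply.
move=> /nbhs_ballP[e /= e0 eP]; exists e => // a b a0 at_ tb b1 abe.
have near s : a <= s <= b -> enorm (c s - c t) < d / 8.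
  move=> /andP[as_ sb]; apply: eP; rewrite /ball/=.
  by rewrite ltr_norml; apply/andP; split; lra.
have depth_near s : a <= s <= b -> d * (7 / 8) <= depth (c s) <= d * (9 / 8).
  move=> /near; have := depth_lip (c s) (c t); rewrite -/d ler_norml.
  by move=> /andP[h1 h2] h3; apply/andP; split; lra.
have ab : a <= b by exact: le_trans tb.
have a01 : 0 <= a <= 1 by rewrite a0; lra.
have b01 : 0 <= b <= 1 by rewrite b1 andbT; lra.
have aa : a <= a <= b by rewrite lexx.
have bb : a <= b <= b by rewrite lexx andbT.
have cab : enorm (c a - c b) <= d / 4.
  have -> : c a - c b = (c a - c t) - (c b - c t).
    by rewrite opprB addrA subrK.
  rewrite (le_trans (ler_enormD _ _))// enormN.
  by have := near _ aa; have := near _ bb; lra.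
have /andP[da1 da2] := depth_near _ aa.
have Gab : `|G a - G b| <= K * (enorm (c a - c b) / depth (c a)).
  have := floc (to_ball u (c a)) (to_ball u (c b)); rewrite !cG//; apply.
  by lra.
apply: (le_trans Gab); rewrite /C -!mulrA.
rewrite [leRHS](_ : _ = K * (4 * (n%:R * I a b))); last by ring.
rewrite ler_wpM2l//.
have da0 : 0 < depth (c a) by lra.
rewrite ler_pdivrMr//.
have cI i : `|(c a - c b) 0 i| <= 9 / 4 * d * I a b.
  rewrite !mxE distrC (le_trans (arc_coord_le uvc i a0 ab b1))//.
  rewrite /I -RintegralZl//; last exact: (arc_integrable_speed uvc).
  apply: le_Rintegral => //.
  - apply: continuous_compact_integrable; first exact: segment_compact.
    apply: continuous_subspaceT => s.
    by apply: (@continuous_comp _ _ _ (derive1 c) enorm);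
      [exact: cc|exact: enorm_continuous].
  - have -> : EFin \o (fun s => 9 / 4 * d * hyperbolic_speed c s) =
      (fun s => (9 / 4 * d)%:E * (EFin \o hyperbolic_speed c) s)%E by [].
    by apply: integrableZl => //; exact: (arc_integrable_speed uvc).
  move=> s /=; rewrite in_itv/= => sab.
  have s01 : 0 <= s <= 1 by move: sab => /andP[? ?]; apply/andP; split; lra.
  have /conformal_ge2/andP[w0 _] := cB _ s01.
  rewrite /hyperbolic_speed mulrA ler_pdivlMr//.
  have [/andP[_ ds] e1] := (depth_near _ sab, enorm_ge0 (derive1 c s)).
  have cs0 := enorm_ge0 (c s).
  have : 1 - enorm (c s) ^+ 2 <= 2 * (d * (9 / 8)).
    by move: ds; rewrite /depth => ds; nra.
  by move=> h; nra.
have I0 : 0 <= I a b.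
  apply: Rintegral_ge0 => s /=; rewrite in_itv/= => /andP[as_ sb].
  apply: le_trans (enorm_ge0 _) (enorm_le_speed uvc _).
  by apply/andP; split; lra.
apply: (le_trans (enorm_le_sum _)).
apply: (@le_trans _ _ (\sum_(i < n) (9 / 4 * d * I a b))).
  by apply: ler_sum => i _; exact: cI.
rewrite sumr_const card_ord -mulr_natl.
have nI : 0 <= n%:R * I a b by rewrite mulr_ge0.
by nra.
Qed.

End hyperbolic_geometry.

(** * Cutoffs, dyadic levels and the model cube *)

Section unit_clamp.
Context {R : realType}.
Implicit Types s t : R.

Definition clamp01 t : R := Num.max 0 (Num.min 1 t).

Lemma clamp01_ge0 t : 0 <= clamp01 t.
Proof. by rewrite le_max lexx. Qed.

Lemma clamp01_le1 t : clamp01 t <= 1.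
Proof. by rewrite ge_max ler01 ge_min lexx. Qed.

Lemma clamp01_0 t : t <= 0 -> clamp01 t = 0.
Proof. by move=> t0; apply/max_l; rewrite ge_min t0 orbT. Qed.

Lemma clamp01_1 t : 1 <= t -> clamp01 t = 1.
Proof. by move=> t1; rewrite /clamp01 (min_l t1) max_r. Qed.

Lemma clamp01_homo : {homo clamp01 : s t / s <= t}.
Proof.
move=> s t st; rewrite /clamp01 ge_max le_max lexx/= le_max; apply/orP; right.
by rewrite le_min !ge_min lexx st orbT.
Qed.

Lemma clamp01_lip s t : `|clamp01 s - clamp01 t| <= `|s - t|.
Proof.
wlog st : s t / s <= t.
  by move=> H; case: (leP s t) => [/H//|/ltW/H]; rewrite distrC (distrC t).
rewrite distrC (distrC s) !ger0_norm ?subr_ge0 ?clamp01_homo//.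
have [s0|s0] := leP s 0.
  rewrite (clamp01_0 s0) subr0 /clamp01 ge_max subr_ge0 st/= ge_min.
  by apply/orP; right; lra.
have [t1|t1] := leP 1 t.
  rewrite (clamp01_1 t1) /clamp01; have [s1|s1] := leP 1 s.
    by rewrite max_r//; lra.
  by rewrite max_r; lra.
have t0 : 0 <= t by lra.
have s1 : s <= 1 by lra.
by rewrite /clamp01 !min_r ?(ltW t1)// !max_r// ltW.
Qed.

Lemma prod_lip (f g f' g' A B : R) : `|f| <= A -> `|g'| <= B ->
  `|f * g - f' * g'| <= A * `|g - g'| + B * `|f - f'|.
Proof.
move=> fA gB; have -> : f * g - f' * g' = f * (g - g') + g' * (f - f') by ring.
by rewrite (le_trans (ler_normD _ _))// !normrM lerD// ler_wpM2r.
Qed.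

End unit_clamp.

Section dyadic_level.
Context {R : realType}.
Implicit Types r : R.

Let level_subproof r : exists m, r <= 2 ^+ m.
Proof.
have [m rm] : exists m : nat, r <= m%:R.
  exists (Num.bound `|r|); apply: le_trans (ler_norm r) _.
  exact/ltW/archi_boundP/normr_ge0.
exists m; apply: (le_trans rm); rewrite -natrX ler_nat.
by apply/ltnW/ltn_expl.
Qed.

Definition level r : nat := ex_minn (level_subproof r).

Lemma level_leq r m : (level r <= m)%N = (r <= 2 ^+ m).
Proof.
rewrite /level; case: ex_minnP => k rk kmin; apply/idP/idP => [km|/kmin//].
by apply: (le_trans rk); rewrite ler_eXn2l// ltr1n.
Qed.

Lemma le_exp_level r : r <= 2 ^+ level r.
Proof. by rewrite -level_leq. Qed.

Lemma lt_level_exp r m : (m < level r)%N -> 2 ^+ m < r.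
Proof. by rewrite ltnNge level_leq -ltNge. Qed.

(** A geometric sum is of the order of its last term, which is less than [r]. *)
Lemma sum_exp_level r : 0 <= r -> \sum_(m < level r) 2 ^+ m <= 2 * r.
Proof.
move=> r0; have [|] := posnP (level r) => [->|].
  by rewrite big_ord0 mulr_ge0.
case lE : (level r) => [//|k] _.
have kr : 2 ^+ k < r by apply: lt_level_exp; rewrite lE.
have sumE : \sum_(m < k.+1) (2 : R) ^+ m = 2 ^+ k.+1 - 1.
  elim: k.+1 => [|j IHj]; first by rewrite big_ord0 expr0 subrr.
  by rewrite big_ord_recr/= IHj exprS; ring.
by rewrite sumE exprS; lra.
Qed.

Lemma sum_widen (N M : nat) (F : nat -> R) : (N <= M)%N ->
  (forall m, (N <= m)%N -> F m = 0) -> \sum_(m < N) F m = \sum_(m < M) F m.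
Proof.
move=> NM F0; rewrite -!(big_mkord xpredT F) [RHS](big_cat_nat (leq0n N) NM)/=.
rewrite [X in _ + X]big_nat_cond [X in _ + X]big1 ?addr0// => m.
by move=> /andP[/andP[/F0]].
Qed.

End dyadic_level.

Section cube_space.
Context {R : realType} {n : nat}.
Implicit Types (u v : 'rV[R]_n) (g : 'rV[R]_n -> R).

Definition cube_proj v : 'rV[R]_n := \row_i Num.max (-1) (Num.min 1 (v 0 i)).

Lemma cube_projE v : `|v| <= 1 -> cube_proj v = v.
Proof.
move=> v1; apply/rowP => i; rewrite mxE.
have /ler_normlP[vi1 vi2] := le_trans (coord_le_norm v i) v1.
by rewrite min_r ?max_r//; lra.
Qed.

Lemma cube_proj_le1 v : `|cube_proj v| <= 1.
Proof.
apply: norm_le => // i; rewrite mxE ler_norml.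
rewrite le_max lexx/= ge_max ge_min lexx/=; lra.
Qed.

Lemma cube_projK v : cube_proj (cube_proj v) = cube_proj v.
Proof. exact/cube_projE/cube_proj_le1. Qed.

Lemma cube_proj0 : cube_proj 0 = 0.
Proof. by rewrite cube_projE// normr0. Qed.

Lemma cube_proj_lip u v : `|cube_proj u - cube_proj v| <= `|u - v|.
Proof.
apply: norm_le => // i; apply: le_trans (coord_le_norm _ i); rewrite !mxE.
have clampE (t : R) : Num.max (-1) (Num.min 1 t) = 2 * clamp01 ((t + 1) / 2) - 1.
  have [t1|t1] := leP t (-1).
    rewrite clamp01_0; last by lra.
    by rewrite min_r ?max_l; lra.
  have [t2|t2] := leP 1 t.
    rewrite clamp01_1; last by lra.
    by rewrite max_r; lra.
  rewrite max_r; last by lra.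
  by rewrite /clamp01 min_r ?max_r; lra.
rewrite !clampE; set a := u 0 i; set b := v 0 i.
have -> : 2 * clamp01 ((a + 1) / 2) - 1 - (2 * clamp01 ((b + 1) / 2) - 1) =
  2 * (clamp01 ((a + 1) / 2) - clamp01 ((b + 1) / 2)) by ring.
have := clamp01_lip ((a + 1) / 2) ((b + 1) / 2).
have -> : (a + 1) / 2 - (b + 1) / 2 = 2^-1 * (a - b) by field.
by rewrite !normrM (ger0_norm (ler0n _ 2)) ger0_norm ?invr_ge0//; lra.
Qed.

Let cube_bnd K g := [/\ g 0 = 0, forall v, g (cube_proj v) = g v
  & forall u v, `|g u - g v| <= K * `|u - v|].

Let cube_bnd0 K : 0 <= K -> cube_bnd K (fun=> 0).
Proof. by move=> K0; split=> // u v; rewrite subrr normr0 mulr_ge0. Qed.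

Let cube_bndB K L f g :
  cube_bnd K f -> cube_bnd L g -> cube_bnd (K + L) (fun t => f t - g t).
Proof.
move=> [f0 fc fK] [g0 gc gL]; split=> [|v|u v]; first by rewrite f0 g0 subrr.
  by rewrite fc gc.
rewrite opprD addrACA -opprD (le_trans (ler_normB _ _))// mulrDl.
by rewrite lerD.
Qed.

Let cube_bndW K L g : K <= L -> cube_bnd K g -> cube_bnd L g.
Proof.
move=> KL [g0 gc gK]; split=> // u v; apply: le_trans (gK u v) _.
by rewrite ler_wpM2r.
Qed.

(** Lipschitz functions on the cube [-1, 1]^n vanishing at its centre, realized
    as functions on the whole space that factor through the projection on the
    cube: being defined and Lipschitz everywhere, they can be cut off freely. *)
Definition cube_space := FSpace cube_bnd0 cube_bndB cube_bndW.

Lemma cube_space_le K g v : 0 <= K -> bnd (A := cube_space) K g -> `|g v| <= K.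
Proof.
move=> K0 [g0 gc gK]; rewrite -gc -[g _]subr0 -g0 (le_trans (gK _ _))//.
by rewrite subr0 ler_piMr// cube_proj_le1.
Qed.

Definition plateau v : R := clamp01 (2 - `|v|).

Lemma plateau_lip u v : `|plateau u - plateau v| <= `|u - v|.
Proof.
apply: (le_trans (clamp01_lip _ _)).
have -> : 2 - `|u| - (2 - `|v|) = `|v| - `|u| by ring.
by rewrite (distrC u); exact: ler_dist_dist.
Qed.

Lemma plateau_mul_lip K g u v : 0 <= K -> bnd (A := cube_space) K g ->
  `|plateau u * g u - plateau v * g v| <= 2 * K * `|u - v|.
Proof.
move=> K0 gK; have [_ _ gl] := gK.
have b1 : `|plateau u| <= 1 by rewrite ger0_norm ?clamp01_ge0 ?clamp01_le1.
apply: (le_trans (prod_lip _ _ b1 (cube_space_le v K0 gK))).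
by have := plateau_lip u v; have := gl u v; nra.
Qed.

Lemma plateau1 v : `|v| <= 1 -> plateau v = 1.
Proof. by move=> v1; apply: clamp01_1; lra. Qed.

Lemma plateau0 v : 2 <= `|v| -> plateau v = 0.
Proof. by move=> v1; apply: clamp01_0; lra. Qed.

End cube_space.
Arguments cube_space : clear implicits.

(** * Euclidean space and sequences of cubes *)

Section euclidean_retracts.
Context {R : realType} {n : nat} (i0 : 'I_n).
Implicit Types (x y u v : 'rV[R]_n).
Local Notation E := (lip_space (0%R : euclidean R n)).
Local Notation Q := (cube_space R n).

Lemma euclidean_mdistE x y :
  mdist (x : euclidean R n) (y : euclidean R n) = enorm (x - y).
Proof. by []. Qed.

Lemma norm_delta : `|delta_mx 0 i0 : 'rV[R]_n| = 1.
Proof.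
apply/le_anti/andP; split; first by rewrite -(enorm_delta i0) norm_le_enorm.
by have := coord_le_norm (delta_mx 0 i0 : 'rV[R]_n) i0; rewrite mxE !eqxx normr1.
Qed.

(** The sum of all [F k x], for a family such that [F k] vanishes outside the
    shell of radius about [2 ^+ k]: the later terms vanish at [x]. *)
Definition annular_sum (F : nat -> 'rV[R]_n -> R) x :=
  \sum_(k < (level `|x|).+1) F k x.

Let active (l k : nat) : bool := (l <= k.+1)%N && (k <= l)%N.

Let sum_active l M : (\sum_(k < M) active l k <= 2)%N.
Proof.
have : (\sum_(k < M) active l k <= minn 2 (M - l.-1))%N.
  elim: M => [|M IH]; first by rewrite big_ord0.
  rewrite big_ord_recr/=; move: IH; rewrite /active /minn.
  by case: (ltnP 2 (M - l.-1)); case: (ltnP 2 (M.+1 - l.-1));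
    case: (leqP l M.+1); case: (leqP M l) => /=; lia.
by move=> /leq_trans; apply; exact: geq_minl.
Qed.

Section annular.
Context (F : nat -> 'rV[R]_n -> R) (C : R).
Hypothesis C0 : 0 <= C.
Hypothesis Flip : forall k x y, `|F k x - F k y| <= C * `|x - y|.
Hypothesis Fout : forall k x, 2 ^+ k.+1 <= `|x| -> F k x = 0.
Hypothesis Fin : forall k x, `|x| <= 2 ^+ k -> F k.+1 x = 0.

Let inactive k x : ~~ active (level `|x|) k -> F k x = 0.
Proof.
rewrite negb_and -!ltnNge => /orP[/lt_level_exp/ltW/Fout//|].
by case: k => [//|k]; rewrite ltnS level_leq => /Fin.
Qed.

Lemma annular_sum_widen x M : (level `|x| < M)%N ->
  annular_sum F x = \sum_(k < M) F k x.
Proof.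
move=> lM; apply: (sum_widen (F := F^~ x)) => // k lk.
by apply: inactive; rewrite negb_and -!ltnNge lk orbT.
Qed.

(** At each of the two points at most two terms are nonzero, so at most four
    terms contribute to the difference. *)
Lemma annular_sum_lip x y :
  `|annular_sum F x - annular_sum F y| <= 4 * C * `|x - y|.
Proof.
pose M := (level `|x| + level `|y|).+1.
rewrite (@annular_sum_widen x M) ?ltnS ?leq_addr//.
rewrite (@annular_sum_widen y M) ?ltnS ?leq_addl//.
rewrite -sumrB (le_trans (ler_norm_sum _ _ _))//.
apply: (@le_trans _ _ (\sum_(k < M)
    ((active (level `|x|) k)%:R + (active (level `|y|) k)%:R) * (C * `|x - y|))).
  apply: ler_sum => k _; have CN : 0 <= C * `|x - y| by rewrite mulr_ge0.
  have [ax|/inactive Fx] := boolP (active (level `|x|) k).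
    by rewrite (le_trans (Flip _ _ _))// ler_peMl// lerDl.
  have [ay|/inactive Fy] := boolP (active (level `|y|) k).
    by rewrite (le_trans (Flip _ _ _))// ler_peMl// lerDr.
  by rewrite Fx Fy subrr normr0 addr0 mul0r.
rewrite -mulr_suml big_split/= -!natr_sum -natrD -mulrA ler_wpM2r ?mulr_ge0//.
by rewrite ler_nat (leq_add (sum_active _ _) (sum_active _ _)).
Qed.

End annular.

Lemma annular_sum_morphism (F : nat -> (power nat Q -> R) -> 'rV[R]_n -> R) c :
  0 <= c ->
  (forall k x, finite_comb (fun g => F k g x)) ->
  (forall K g, 0 <= K -> bnd (A := power nat Q) K g ->
    [/\ forall k x y, `|F k g x - F k g y| <= c * K * `|x - y|,
     forall k x, 2 ^+ k.+1 <= `|x| -> F k g x = 0 &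
     forall k x, `|x| <= 2 ^+ k -> F k.+1 g x = 0]) ->
  (forall K g, 0 <= K -> bnd (A := power nat Q) K g -> F 0%N g 0 = 0) ->
  morphism (A := power nat Q) (B := E) (fun g => annular_sum (fun k => F k g)).
Proof.
move=> c0 fF FP F0; split=> [x|]; first exact: finite_comb_sum.
exists (4 * c) => [|K g K0 gK]; first by rewrite mulr_ge0.
have [F1 F2 F3] := FP K g K0 gK; have cK0 : 0 <= c * K by rewrite mulr_ge0.
split=> [|x y].
  rewrite /annular_sum big1// => -[[|k] klt] _ /=; first exact: F0 gK.
  by rewrite F3// normr0 exprn_ge0.
apply: (le_trans (annular_sum_lip cK0 F1 F2 F3 x y)).
rewrite mulrA ler_wpM2l ?mulr_ge0//; exact: norm_le_enorm.
Qed.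

Lemma euclidean_chart (a r : R) v : 0 < a -> 0 <= r ->
  forall K (f : euclidean R n -> R), 0 <= K -> bnd (A := E) K f ->
  bnd (A := Q) (r / a * n%:R * K)
    (fun u => a^-1 * (f (v + r *: cube_proj u : 'rV[R]_n) - f v)).
Proof.
move=> a0 r0 K f K0 [f0 fK]; split=> [|u|u w].
- by rewrite cube_proj0 scaler0 addr0 subrr mulr0.
- by rewrite cube_projK.
rewrite -mulrBr opprB addrA subrK normrM gtr0_norm ?invr_gt0//.
rewrite [leRHS](_ : _ = a^-1 * (K * (n%:R * (r * `|u - w|)))); last by ring.
rewrite ler_wpM2l ?invr_ge0 ?(ltW a0)//.
apply: (le_trans (fK _ _)); rewrite ler_wpM2l// euclidean_mdistE.
apply: (le_trans (enorm_le_norm _)); rewrite ler_wpM2l//.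
rewrite opprD addrACA subrr add0r -scalerBr normrZ ger0_norm// ler_wpM2l//.
exact: cube_proj_lip.
Qed.

Let center k : 'rV[R]_n := (2 ^+ k) *: delta_mx 0 i0.
Let radius k : R := 2 ^+ k / 8.

Let radius_gt0 k : 0 < radius k.
Proof. by rewrite divr_gt0// exprn_gt0. Qed.

Let center_norm k : `|center k| = 2 ^+ k.
Proof. by rewrite normrZ norm_delta mulr1 ger0_norm// exprn_ge0. Qed.

Let far_center k x : 2 <= `|(radius k)^-1 *: (x - center k)| \/
  3 / 4 * 2 ^+ k < `|x| < 5 / 4 * 2 ^+ k.
Proof.
have [|lt2] := leP 2 `|(radius k)^-1 *: (x - center k)|; [by left|right].
move: lt2; rewrite normrZ gtr0_norm ?invr_gt0// mulrC ltr_pdivrMr//.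
rewrite /radius; have := ler_dist_dist x (center k); rewrite center_norm.
by rewrite ler_norml => /andP[h1 h2] h3; apply/andP; split; lra.
Qed.

(** The cubes of size [2 ^+ k / 8] around the points of norm [2 ^+ k] on an axis
    are so far apart that their doubles lie in disjoint shells: a family of
    functions on the cubes, extended by [plateau], is recovered by restriction. *)
Lemma cubes_retract_euclidean : retract (power nat Q) E.
Proof.
pose F k (g : power nat Q -> R) x :=
  let u : 'rV[R]_n := (radius k)^-1 *: (x - center k) in
  radius k * (plateau u * g ((k, u) : nat * 'rV[R]_n)).
have F0 k g x : `|x| <= 3 / 4 * 2 ^+ k \/ 5 / 4 * 2 ^+ k <= `|x| -> F k g x = 0.
  move=> h; rewrite /F plateau0 ?mul0r ?mulr0//.
  by have [//|/andP[h1 h2]] := far_center k x; case: h; lra.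
have e0 k : 0 < (2 : R) ^+ k by exact: exprn_gt0.
exists (fun g => annular_sum (fun k => F k g)),
  (fun f ku => (radius ku.1)^-1 *
    (f (center ku.1 + radius ku.1 *: cube_proj ku.2) - f (center ku.1))).
split.
- apply: (@annular_sum_morphism _ 2) => //.
  + move=> k x; apply: finite_combZ; apply: finite_combZ.
    exact: finite_comb_eval.
  + move=> K g K0 gK; split=> [k x y|k x|k x] /=.
    * rewrite -mulrBr normrM gtr0_norm//.
      apply: (@le_trans _ _ (radius k * (2 * K * ((radius k)^-1 * `|x - y|)))).
        rewrite ler_pM2l//; apply: (le_trans (plateau_mul_lip _ _ K0 (gK k))).
        rewrite ler_wpM2l ?mulr_ge0// -scalerBr normrZ.
        rewrite gtr0_norm ?invr_gt0// opprB addrA subrK//.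
      by rewrite mulrCA mulVKf ?gt_eqF.
    * by rewrite exprS => h; apply: F0; right; have := e0 k; lra.
    * by move=> h; apply: F0; left; rewrite exprS; have := e0 k; lra.
  + by move=> K g K0 gK; apply: F0; left; rewrite normr0 expr0; lra.
- refine (@morphism_power R nat E Q (1 * n%:R) (fun k (f : E -> R) u =>
    (radius k)^-1 * (f (center k + radius k *: cube_proj u) - f (center k))) _ _ _).
  + by rewrite mul1r.
  + move=> k u; apply: finite_combZ; apply: finite_combB; exact: finite_comb_eval.
  + move=> k K f K0 fK.
    have := euclidean_chart (center k) (radius_gt0 k) (ltW (radius_gt0 k)) K0 fK.
    by rewrite divff// gt_eqF.
- move=> g [K K0 gK]; apply/funext => -[k u] /=.
  have sumE x : 3 / 4 * 2 ^+ k < `|x| < 5 / 4 * 2 ^+ k ->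
      annular_sum (fun j => F j g) x = F k g x.
    move=> /andP[x1 x2].
    have Fj0 j : j != k -> F j g x = 0.
      rewrite neq_ltn => /orP[jk|kj]; apply: F0.
        right; have : (2 : R) ^+ j.+1 <= 2 ^+ k by rewrite ler_eXn2l ?ltr1n.
        by rewrite exprS; have := e0 j; lra.
      left; have : (2 : R) ^+ k.+1 <= 2 ^+ j by rewrite ler_eXn2l ?ltr1n.
      by rewrite exprS; have := e0 k; lra.
    rewrite /annular_sum; have [klt|kge] := ltnP k (level `|x|).+1.
      rewrite (bigD1 (Ordinal klt))//= big1 ?addr0// => j jk; apply: Fj0.
      by apply: contra jk => /eqP jk; apply/eqP/val_inj.
    have : `|x| <= 2 ^+ k.-1 by rewrite -level_leq -ltnS (ltn_predK kge).
    by rewrite -(ltn_predK kge) exprS in x1 *; have := e0 k.-1; lra.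
  have small u' : `|u'| <= 1 ->
      3 / 4 * 2 ^+ k < `|center k + radius k *: u'| < 5 / 4 * 2 ^+ k.
    move=> u1; have := ler_dist_dist (center k + radius k *: u') (center k).
    rewrite addrAC subrr add0r center_norm normrZ gtr0_norm//.
    rewrite ler_norml => /andP[h1 h2]; have := e0 k.
    have : radius k * `|u'| <= radius k by rewrite ler_piMr// ltW.
    by rewrite {2}/radius => h3 h4; apply/andP; split; lra.
  have FE u' : `|u'| <= 1 -> F k g (center k + radius k *: u') = radius k * g (k, u').
    move=> u1; rewrite /F addrAC subrr add0r scalerA mulVf ?gt_eqF// scale1r.
    by rewrite plateau1// mul1r.
  have [g0 gc _] := gK k.
  rewrite !sumE; first last.
  - by apply: small; exact: cube_proj_le1.
  - by have := small 0; rewrite normr0 scaler0 addr0; apply.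
  have -> : F k g (center k) = 0.
    have := FE 0; rewrite normr0 scaler0 addr0 => ->//; by rewrite g0 mulr0.
  by rewrite FE ?cube_proj_le1// subr0 mulKf ?gt_eqF// gc.
Qed.

Definition cutoff k x : R := if k is j.+1 then clamp01 (2 - `|x| / 2 ^+ j) else 0.

Lemma cutoff_range k x : 0 <= cutoff k x <= 1.
Proof. by case: k => [|k]/=; rewrite ?lexx ?ler01// clamp01_ge0 clamp01_le1. Qed.

Lemma cutoff_lip k x y : `|cutoff k.+1 x - cutoff k.+1 y| <= `|x - y| / 2 ^+ k.
Proof.
apply: (le_trans (clamp01_lip _ _)).
have -> : 2 - `|x| / 2 ^+ k - (2 - `|y| / 2 ^+ k) = (`|y| - `|x|) / 2 ^+ k by ring.
have e0 : 0 < ((2 : R) ^+ k)^-1 by rewrite invr_gt0 exprn_gt0.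
by rewrite normrM (gtr0_norm e0) ler_pM2r// distrC ler_dist_dist.
Qed.

Lemma cutoff_out k x : 2 ^+ k.+1 <= `|x| -> cutoff k.+1 x = 0.
Proof.
move=> h; apply: clamp01_0; rewrite subr_le0 ler_pdivlMr ?exprn_gt0//.
by rewrite -exprS.
Qed.

Lemma cutoff_in k x : `|x| <= 2 ^+ k -> cutoff k.+1 x = 1.
Proof.
move=> h; apply: clamp01_1; rewrite lerBrDr -lerBrDl.
by rewrite ler_pdivrMr ?exprn_gt0//; lra.
Qed.

(** A partition of unity: shell 0 is the unit ball with its collar, shell
    [k.+1] lies between the radii [2 ^+ k] and [2 ^+ k.+2]. *)
Definition shell k x := cutoff k.+1 x - cutoff k x.

Lemma shell_le1 k x : `|shell k x| <= 1.
Proof.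
have /andP[a0 a1] := cutoff_range k.+1 x; have /andP[b0 b1] := cutoff_range k x.
by rewrite ler_norml; apply/andP; split; rewrite /shell; lra.
Qed.

Lemma shell_lip k x y : `|shell k x - shell k y| <= 3 * `|x - y| / 2 ^+ k.
Proof.
have -> : shell k x - shell k y =
    (cutoff k.+1 x - cutoff k.+1 y) - (cutoff k x - cutoff k y).
  by rewrite /shell; ring.
rewrite (le_trans (ler_normB _ _))// [leRHS](_ : _ =
  `|x - y| / 2 ^+ k + 2 * (`|x - y| / 2 ^+ k)); last by ring.
have d0 j : 0 <= `|x - y| / 2 ^+ j by rewrite divr_ge0// exprn_ge0.
rewrite lerD ?cutoff_lip//; case: k => [|k].
  by rewrite /= subrr normr0 mulr_ge0.
apply: (le_trans (cutoff_lip _ _ _)); rewrite le_eqVlt; apply/orP; left.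
by apply/eqP; rewrite exprS; field; rewrite expf_neq0.
Qed.

(** Restrict [f] to all the cubes of size [2 ^+ k.+1], rescale, and glue by means
    of the shells.  On the cube the restriction is bounded by a multiple of
    [2 ^+ k] because it vanishes at 0, which offsets the slope of the shell. *)
Lemma euclidean_retract_cubes : retract E (power nat Q).
Proof.
pose G k (g : power nat Q -> R) x : R :=
  2 ^+ k.+1 * g (k, (2 ^+ k.+1)^-1 *: x).
pose F k g x := shell k x * G k g x.
have e0 k : 0 < (2 : R) ^+ k by exact: exprn_gt0.
exists (fun f ku => (2 ^+ ku.1.+1)^-1 * f (2 ^+ ku.1.+1 *: cube_proj ku.2)),
  (fun g => annular_sum (fun k => F k g)).
split.
- refine (@morphism_power R nat E Q n%:R (fun k (f : E -> R) u =>
    (2 ^+ k.+1)^-1 * f (2 ^+ k.+1 *: cube_proj u)) _ _ _) => //.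
  + by move=> k u; apply: finite_combZ; exact: finite_comb_eval.
  + move=> k K f K0 fK; have [f0 _] := fK.
    have := euclidean_chart 0 (e0 k.+1) (ltW (e0 k.+1)) K0 fK.
    rewrite divff ?gt_eqF// mul1r; congr (bnd _ _); apply/funext => u.
    by rewrite add0r f0 subr0.
- apply: (@annular_sum_morphism _ 7) => //.
  + move=> k x; apply: finite_combZ; apply: finite_combZ.
    exact: finite_comb_eval.
  + move=> K g K0 gK; split=> [k x y|k x h|k x h] /=.
    * have [_ _ gl] := gK k.
      have GK : `|G k g y| <= 2 ^+ k.+1 * K.
        rewrite normrM gtr0_norm// ler_pM2l//.
        exact: (cube_space_le _ K0 (gK k)).
      have Gl : `|G k g x - G k g y| <= K * `|x - y|.
        rewrite -mulrBr normrM gtr0_norm//.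
        apply: (@le_trans _ _ (2 ^+ k.+1 * (K * ((2 ^+ k.+1)^-1 * `|x - y|)))).
          rewrite ler_pM2l//; apply: (le_trans (gl _ _)).
          by rewrite -scalerBr normrZ gtr0_norm ?invr_gt0.
        by rewrite mulrCA mulVKf ?gt_eqF.
      apply: (le_trans (prod_lip _ _ (shell_le1 k x) GK)).
      rewrite mul1r; apply: (@le_trans _ _ (K * `|x - y| +
          2 ^+ k.+1 * K * (3 * `|x - y| / 2 ^+ k))).
        by rewrite lerD// ler_wpM2l ?shell_lip// mulr_ge0// ltW.
      rewrite le_eqVlt; apply/orP; left; apply/eqP.
      by rewrite exprS; field; rewrite gt_eqF.
    * rewrite /F /shell cutoff_out// sub0r; case: k h => [|k] h.
        by rewrite /= oppr0 mul0r.
      rewrite cutoff_out ?oppr0 ?mul0r// (le_trans _ h)//.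
      by rewrite ler_eXn2l ?ltr1n.
    * rewrite /F /shell !cutoff_in ?subrr ?mul0r// (le_trans h)//.
      by rewrite ler_eXn2l ?ltr1n.
  + move=> K g K0 gK; have [g0 _ _] := gK 0%N.
    by rewrite /F /G scaler0 g0 !mulr0.
- move=> f [K K0 [f0 fK]]; apply/funext => x /=.
  rewrite /annular_sum (eq_bigr (fun k : 'I__ => shell k x * f x)); last first.
    move=> k _; rewrite /F; have [->|s0] := eqVneq (shell k x) 0.
      by rewrite !mul0r.
    have xk : `|x| <= 2 ^+ k.+1.
      rewrite leNgt; apply: contra s0 => /ltW h; rewrite /shell cutoff_out// sub0r.
      case: (nat_of_ord k) h => [|j] h; first by rewrite /= oppr0.
      by rewrite cutoff_out ?oppr0// (le_trans _ h)// ler_eXn2l ?ltr1n.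
    rewrite /G /= mulVKf ?gt_eqF// cube_projE; last first.
      by rewrite normrZ gtr0_norm ?invr_gt0// mulrC ler_pdivrMr// mul1r.
    by rewrite scalerA divff ?scale1r// gt_eqF.
  rewrite -mulr_suml -(big_mkord xpredT (fun k => shell k x)).
  by rewrite telescope_sumr// cutoff_in ?le_exp_level//= subr0 mul1r.
Qed.

End euclidean_retracts.

(** * Interpolation on dyadic grids *)

Section grid_partition.
Context {R : realType}.
Implicit Types s t : R.

(** Each [clamp01 (s - j)] is the part of [0, s] in the interval [j, j + 1]. *)
Lemma sum_clamp01 M s : \sum_(j < M) clamp01 (s - j%:R) = Num.max 0 (Num.min M%:R s).
Proof.
elim: M => [|M IHM].
  by rewrite big_ord0; apply/esym/max_l; rewrite ge_min lexx.
rewrite big_ord_recr/= IHM -natr1; have [sM|Ms] := leP s M%:R.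
  rewrite clamp01_0 ?subr_le0// addr0; congr Num.max.
  by rewrite min_r// (le_trans sM)// lerDl.
rewrite (max_r (ler0n _ _)); have [sM|Ms1] := leP (M%:R + 1) s.
  by rewrite clamp01_1 ?max_r ?addr_ge0//; lra.
rewrite /clamp01 min_r; last by lra.
rewrite !max_r; first by ring.
  by have := ler0n R M; lra.
by lra.
Qed.

(** All the differences have the same sign, so the sum of their absolute values
    is a difference of two values of the clamp of [sum_clamp01]. *)
Lemma sum_clamp01_lip M s t :
  \sum_(j < M) `|clamp01 (s - j%:R) - clamp01 (t - j%:R)| <= `|s - t|.
Proof.
wlog st : s t / t <= s.
  move=> H; case: (leP t s) => [/H//|/ltW/H]; rewrite distrC.
  by under eq_bigr do rewrite distrC.
under eq_bigr do rewrite ger0_norm ?subr_ge0 ?clamp01_homo ?lerB//.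
rewrite sumrB !sum_clamp01 ger0_norm ?subr_ge0//.
have M0 := ler0n R M.
have minE (r : R) : r <= 0 -> Num.max 0 (Num.min M%:R r) = 0.
  by move=> r0; apply: max_l; rewrite ge_min r0 orbT.
have [s0|s0] := leP s 0; first by rewrite !minE ?subrr ?subr_ge0//; lra.
have [t0|t0] := leP t 0.
  rewrite (minE t)// subr0 ge_max ge_min; apply/andP; split; first by lra.
  by apply/orP; right; lra.
have {s0}s0 := ltW s0; have {t0}t0 := ltW t0.
by have [] := leP M%:R s; have [] := leP M%:R t => *; rewrite !max_r//; lra.
Qed.

(** The piecewise linear function with value 1 at the node [j / 2 ^+ m - 1] and 0
    at the other ones.  As a difference of consecutive clamps it makes both the
    sum over [j] and the total variation easy to evaluate. *)
Definition tent m (j : nat) t : R :=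
  clamp01 (2 ^+ m * (t + 1) + 1 - j%:R) - clamp01 (2 ^+ m * (t + 1) - j%:R).

Lemma tent_ge0 m j t : 0 <= tent m j t.
Proof. by rewrite subr_ge0 clamp01_homo// lerB// lerDl. Qed.

Lemma tent_sum m t : `|t| <= 1 -> \sum_(j < (2 ^ m.+1).+1) tent m j t = 1.
Proof.
rewrite ler_norml => /andP[t1 t2]; have e0 : 0 < (2 : R) ^+ m by exact: exprn_gt0.
have s0 : 0 <= 2 ^+ m * (t + 1) by rewrite mulr_ge0 ?(ltW e0)//; lra.
have s1 : 2 ^+ m * (t + 1) <= 2 ^+ m.+1.
  by rewrite exprSr ler_pM2l//; lra.
rewrite /tent sumrB !sum_clamp01 -natr1 natrX.
rewrite min_r ?lerD2r// max_r ?addr_ge0// min_r; last first.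
  by rewrite (le_trans s1)// lerDl.
by rewrite max_r// addrAC subrr add0r.
Qed.

Lemma tent_tv m M s t :
  \sum_(j < M) `|tent m j s - tent m j t| <= 2 * 2 ^+ m * `|s - t|.
Proof.
apply: (@le_trans _ _ (\sum_(j < M)
   (`|clamp01 (2 ^+ m * (s + 1) + 1 - j%:R) - clamp01 (2 ^+ m * (t + 1) + 1 - j%:R)| +
    `|clamp01 (2 ^+ m * (s + 1) - j%:R) - clamp01 (2 ^+ m * (t + 1) - j%:R)|))).
  apply: ler_sum => j _; rewrite /tent; set a := clamp01 _; set b := clamp01 _.
  set c := clamp01 _; set d := clamp01 _.
  have -> : a - b - (c - d) = (a - c) - (b - d) by ring.
  exact: ler_normB.
rewrite big_split/= [leRHS](_ : _ = 2 ^+ m * `|s - t| + 2 ^+ m * `|s - t|);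
  last by ring.
have e0 : 0 <= (2 : R) ^+ m by exact: exprn_ge0.
rewrite lerD// (le_trans (sum_clamp01_lip _ _ _))//.
  have -> : 2 ^+ m * (s + 1) + 1 - (2 ^+ m * (t + 1) + 1) = 2 ^+ m * (s - t) by ring.
  by rewrite normrM ger0_norm.
have -> : 2 ^+ m * (s + 1) - (2 ^+ m * (t + 1)) = 2 ^+ m * (s - t) by ring.
by rewrite normrM ger0_norm.
Qed.

Lemma tent_supp m j t : tent m j t != 0 ->
  `|t - (j%:R / 2 ^+ m - 1)| <= (2 ^+ m)^-1.
Proof.
have e0 : 0 < (2 : R) ^+ m by exact: exprn_gt0.
move=> t0; set s := 2 ^+ m * (t + 1) - j%:R.
have -> : t - (j%:R / 2 ^+ m - 1) = s / 2 ^+ m.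
  by rewrite /s; field; rewrite gt_eqF.
rewrite normrM (gtr0_norm (x := _^-1)) ?invr_gt0// ler_piMl ?invr_ge0 ?(ltW e0)//.
rewrite leNgt; apply: contra t0 => s1; rewrite /tent.
have -> : 2 ^+ m * (t + 1) + 1 - j%:R = s + 1 by rewrite /s; ring.
rewrite -/s; move: s1; rewrite ltr_normr => /orP[s1|s1].
  by rewrite !clamp01_1 ?subrr//; lra.
by rewrite !clamp01_0 ?subrr//; lra.
Qed.

(** The total variation distance between product measures is at most the sum of
    those between the factors: replace the factors one at a time. *)
Lemma prod_tv (n : nat) (J : finType) (a b : 'I_n -> J -> R) :
  (forall k j, 0 <= a k j) -> (forall k j, 0 <= b k j) ->
  (forall k, \sum_j a k j = 1) -> (forall k, \sum_j b k j = 1) ->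
  \sum_(i : {ffun 'I_n -> J}) `|\prod_k a k (i k) - \prod_k b k (i k)| <=
  \sum_k \sum_j `|a k j - b k j|.
Proof.
move=> a0 b0 a1 b1.
pose W (k l : 'I_n) j : R := if l == k then `|a k j - b k j| else
  if (l < k)%N then a l j else b l j.
apply: (@le_trans _ _ (\sum_(i : {ffun 'I_n -> J}) \sum_k \prod_l W k l (i l))).
  apply: ler_sum => i _.
  (* The factors of index less than k come from a, the other ones from b. *)
  pose P (k : nat) : R := \prod_(l < n) (if (l < k)%N then a l (i l) else b l (i l)).
  have -> : \prod_k a k (i k) = P n by apply: eq_bigr => l _; rewrite ltn_ord.
  have -> : \prod_k b k (i k) = P 0%N by apply: eq_bigr => l _.
  rewrite -telescope_sumr// big_mkord (le_trans (ler_norm_sum _ _ _))//.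
  apply: ler_sum => k _; rewrite /P (bigD1 k)//= ltnSn.
  rewrite [X in _ - X](bigD1 k)//= ltnn.
  rewrite (eq_bigr (fun l : 'I_n => if (l < k)%N then a l (i l) else b l (i l))).
    rewrite -mulrBl normrM [leRHS](bigD1 k)//= {1}/W eqxx ler_wpM2l//.
    rewrite ger0_norm; last first.
      by apply: prodr_ge0 => l _; case: ifP.
    rewrite le_eqVlt; apply/orP; left; apply/eqP; apply: eq_bigr => l lk.
    by rewrite /W (negbTE lk).
  by move=> l lk; rewrite ltnS leq_eqVlt -[(_ == _) as X in X || _]/(l == k) (negbTE lk).
rewrite exchange_big/=; apply: ler_sum => k _.
have -> : \sum_(i : {ffun 'I_n -> J}) \prod_l W k l (i l) =
  \prod_l \sum_j W k l j by rewrite bigA_distr_bigA.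
rewrite (bigD1 k)//=; have -> : \prod_(l < n | l != k) \sum_j W k l j = 1.
  apply: big1 => l lk; under eq_bigr => j _ do rewrite /W (negbTE lk).
  by case: (l < k)%N.
rewrite mulr1 le_eqVlt; apply/orP; left; apply/eqP.
by apply: eq_bigr => j _; rewrite /W eqxx.
Qed.

Lemma average_le (I : finType) (w G : I -> R) B : (forall i, 0 <= w i) ->
  \sum_i w i = 1 -> (forall i, `|G i| <= B) -> `|\sum_i w i * G i| <= B.
Proof.
move=> w0 w1 GB; rewrite (le_trans (ler_norm_sum _ _ _))//.
rewrite -[leRHS]mul1r -w1 mulr_suml; apply: ler_sum => i _.
by rewrite normrM ger0_norm// ler_wpM2l.
Qed.

(** Averages of bounded quantities depend on the weights through their total
    variation only, whatever the number of terms. *)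
Lemma average_lip (I : finType) (w w' G G' : I -> R) B D :
  (forall i, 0 <= w i) -> \sum_i w i = 1 ->
  (forall i, `|G i - G' i| <= D) -> (forall i, `|G' i| <= B) ->
  `|\sum_i w i * G i - \sum_i w' i * G' i| <= D + B * \sum_i `|w i - w' i|.
Proof.
move=> w0 w1 GD GB; rewrite -sumrB.
rewrite (eq_bigr (fun i => w i * (G i - G' i) + (w i - w' i) * G' i)); last first.
  by move=> i _; ring.
rewrite big_split/= (le_trans (ler_normD _ _))//.
apply: lerD; first exact: average_le.
rewrite (le_trans (ler_norm_sum _ _ _))// mulr_sumr; apply: ler_sum => i _.
by rewrite normrM mulrC ler_wpM2r.
Qed.

Context {n : nat}.
Implicit Types x y : 'rV[R]_n.

Definition grid m : finType := {ffun 'I_n -> 'I_(2 ^ m.+1).+1}.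

(** The multilinear interpolation weights of the grid of mesh [2^-m] on
    [-1, 1]^n. *)
Definition hat m (i : grid m) x : R := \prod_k tent m (i k) (x 0 k).

Definition node m (i : grid m) : 'rV[R]_n := \row_k ((i k)%:R / 2 ^+ m - 1).

Lemma hat_ge0 m (i : grid m) x : 0 <= hat i x.
Proof. by apply: prodr_ge0 => k _; exact: tent_ge0. Qed.

Lemma hat_sum m x : `|x| <= 1 -> \sum_(i : grid m) hat i x = 1.
Proof.
move=> x1; have -> : \sum_(i : grid m) hat i x =
    \prod_(k < n) \sum_(j < (2 ^ m.+1).+1) tent m j (x 0 k).
  by rewrite bigA_distr_bigA.
rewrite big1// => k _.
exact/tent_sum/(le_trans (coord_le_norm _ _)).
Qed.

Lemma hat_supp m (i : grid m) x : hat i x != 0 -> `|x - node i| <= (2 ^+ m)^-1.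
Proof.
move=> /prodf_neq0 i0; apply: norm_le => [|k]; first by rewrite invr_ge0 exprn_ge0.
by rewrite !mxE; apply: tent_supp; exact: i0.
Qed.

Lemma hat_tv m x y : `|x| <= 1 -> `|y| <= 1 ->
  \sum_(i : grid m) `|hat i x - hat i y| <= 2 * n%:R * 2 ^+ m * `|x - y|.
Proof.
move=> x1 y1.
pose T (z : 'rV[R]_n) (k : 'I_n) (j : 'I_(2 ^ m.+1).+1) : R :=
  tent m j (z 0 k).
have T0 z k j : 0 <= T z k j by exact: tent_ge0.
have T1 z k : `|z| <= 1 -> \sum_j T z k j = 1.
  by move=> z1; exact/tent_sum/(le_trans (coord_le_norm _ _)).
have := prod_tv (T0 x) (T0 y) (fun k => T1 x k x1) (fun k => T1 y k y1).
move=> /le_trans; apply.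
rewrite [leRHS](_ : _ = \sum_(k < n) (2 * 2 ^+ m * `|x - y|)).
  apply: ler_sum => k _; rewrite (le_trans (tent_tv _ _ _ _))//.
  rewrite ler_wpM2l ?mulr_ge0 ?exprn_ge0//.
  by have := coord_le_norm (x - y) k; rewrite !mxE.
by rewrite sumr_const card_ord -mulr_natl; ring.
Qed.

End grid_partition.

(** * Hyperbolic space and sequences of cubes *)

Section hyperbolic_retracts.
Context {R : realType} {n : nat} (i0 : 'I_n).
Local Notation pos := (@hyperbolic_val R n).
Local Notation Q := (cube_space R n).
Local Notation N := (n%:R : R).
Implicit Types (x y : hyperbolic R n) (u v p : 'rV[R]_n).

Lemma hyp_origin_subproof : enorm (0 : 'rV[R]_n) < 1.
Proof. by rewrite enorm0. Qed.

Definition hyp_origin : hyperbolic R n := Hyperbolic hyp_origin_subproof.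

Local Notation H := (lip_space hyp_origin).
Local Notation B := (to_ball hyp_origin).

Lemma to_ball_pos x : B (pos x) = x.
Proof. by case: x => v v1; apply/val_inj/to_ballK. Qed.

Lemma to_ball_depth v : 0 < depth v -> pos (B v) = v.
Proof. by rewrite subr_gt0; exact: to_ballK. Qed.

Lemma ball_norm_le1 x : `|pos x| <= 1.
Proof.
by case: x => v v1; rewrite (le_trans (norm_le_enorm _))// ltW.
Qed.

Lemma depth_le1 v : depth v <= 1.
Proof. by rewrite gerBl enorm_ge0. Qed.

Lemma depth_near v p r : `|v - p| <= r -> depth p - N * r <= depth v.
Proof.
move=> vp; have := depth_lip v p; rewrite ler_norml => /andP[h _].
have h2 : enorm (v - p) <= N * r.
  by rewrite (le_trans (enorm_le_norm _))// ler_wpM2l.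
by lra.
Qed.

Let N1 : 1 <= N.
Proof. by rewrite ler1n (leq_ltn_trans _ (ltn_ord i0)). Qed.

Let e0 m : 0 < (2 : R) ^+ m. Proof. exact: exprn_gt0. Qed.

Lemma lip_step K (f : hyperbolic R n -> R) v p a : 0 <= K -> bnd (A := H) K f ->
  0 < a -> a <= depth v -> a <= depth p ->
  `|f (B v) - f (B p)| <= 2 * N / a * K * `|v - p|.
Proof.
move=> K0 [_ fK] a0 av ap; apply: (le_trans (fK _ _)).
have vE := to_ball_depth (lt_le_trans a0 av).
have pE := to_ball_depth (lt_le_trans a0 ap).
have := @hyperbolic_dist_segment R n (B v) (B p) a a0; rewrite vE pE.
move=> /(_ av ap) h; rewrite -!mulrA mulrC.
rewrite [leRHS](_ : _ = (2 * (N * `|v - p|) / a) * K); last by ring.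
rewrite ler_wpM2r// (le_trans h)// ler_wpM2r ?invr_ge0 ?(ltW a0)//.
by rewrite ler_wpM2l// enorm_le_norm.
Qed.

Lemma hyperbolic_chart p r a : 0 < a -> 0 <= r -> a + N * r <= depth p ->
  forall K (f : hyperbolic R n -> R), 0 <= K -> bnd (A := H) K f ->
  bnd (A := Q) (2 * N * r / a * K)
    (fun u => f (B (p + r *: cube_proj u)) - f (B p)).
Proof.
move=> a0 r0 ap K f K0 fK.
have da u : a <= depth (p + r *: cube_proj u).
  apply: le_trans (depth_near (p := p) (r := r) _); first by lra.
  rewrite addrAC subrr add0r normrZ ger0_norm// ler_piMr//.
  exact: cube_proj_le1.
split=> [|u|u v].
- by rewrite cube_proj0 scaler0 addr0 subrr.
- by rewrite cube_projK.
rewrite opprB addrA subrK; apply: (le_trans (lip_step K0 fK a0 (da u) (da v))).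
have c0 : 0 <= 2 * N / a * K by rewrite mulr_ge0// divr_ge0 ?(ltW a0)// mulr_ge0.
rewrite [leRHS](_ : _ = 2 * N / a * K * (r * `|u - v|)); last by ring.
rewrite ler_wpM2l// opprD addrACA subrr add0r -scalerBr normrZ ger0_norm//.
by rewrite ler_wpM2l// cube_proj_lip.
Qed.

(** The sum of all [F m x], for a family such that [F m] vanishes at depths
    from [tau / 2 ^+ m] on. *)
Definition layer_sum tau (F : nat -> hyperbolic R n -> R) x :=
  \sum_(m < level (tau / depth (pos x))) F m x.

Section layers.
Context (tau : R) (tau0 : 0 <= tau) (F : nat -> hyperbolic R n -> R).
Hypothesis Fdeep : forall m x, tau <= 2 ^+ m * depth (pos x) -> F m x = 0.

Lemma layer_sum_widen x M : tau <= 2 ^+ M * depth (pos x) ->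
  layer_sum tau F x = \sum_(m < M) F m x.
Proof.
have d0 := depth_gt0 x; move=> tM; apply: (sum_widen (F := F^~ x)).
  by rewrite level_leq ler_pdivrMr.
by move=> m; rewrite level_leq ler_pdivrMr//; exact: Fdeep.
Qed.

(** At depth d only the terms with [2 ^+ m < tau / d] are nonzero; their slopes
    [A * 2 ^+ m] form a geometric sum of order [A * tau / d], which is a bounded
    slope for the hyperbolic distance. *)
Lemma layer_sum_lip A : 0 <= A ->
  (forall m x y, `|F m x - F m y| <= A * 2 ^+ m * `|pos x - pos y|) ->
  forall x y, `|layer_sum tau F x - layer_sum tau F y| <=
    16 * N * tau * A * mdist x y.
Proof.
move=> A0 FA x y.
rewrite [_ * A](_ : _ = 4 * N * (4 * tau * A)); last by ring.
apply: lipschitz_of_local; first by rewrite !mulr_ge0.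
move=> {}x {}y xy; have dx := depth_gt0 x; have dy := depth_gt0 y.
have dxy : depth (pos x) / 2 <= depth (pos y).
  by have := depth_lip (pos x) (pos y); rewrite ler_norml => /andP[_]; lra.
(* The depth of y is at least half that of x: doubling tau gives a number of
   terms which is sufficient at both points. *)
have [M ME] : exists M, M = level (2 * tau / depth (pos x)) by eexists.
have tM : 2 * tau <= 2 ^+ M * depth (pos x).
  by rewrite -ler_pdivrMr// ME le_exp_level.
have tx : tau <= 2 ^+ M * depth (pos x) by apply: le_trans tM; rewrite ler_peMl// ler1n.
have ty : tau <= 2 ^+ M * depth (pos y).
  have : 2 ^+ M * (depth (pos x) / 2) <= 2 ^+ M * depth (pos y) by rewrite ler_pM2l.
  by apply: le_trans; rewrite mulrA ler_pdivlMr// mulrC.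
rewrite (layer_sum_widen tx) (layer_sum_widen ty).
rewrite -sumrB (le_trans (ler_norm_sum _ _ _))//.
apply: (@le_trans _ _ (\sum_(m < M) 2 ^+ m * (A * `|pos x - pos y|))).
  by apply: ler_sum => m _; rewrite mulrCA mulrA; exact: FA.
have r0 : 0 <= 2 * tau / depth (pos x) by rewrite divr_ge0 ?mulr_ge0// ltW.
have Axy : 0 <= A * `|pos x - pos y| by rewrite mulr_ge0.
rewrite -mulr_suml ME; apply: (le_trans (ler_wpM2r Axy (sum_exp_level r0))).
rewrite [leRHS](_ : _ =
  2 * (2 * tau / depth (pos x)) * (A * enorm (pos x - pos y))); last by ring.
apply: ler_wpM2l; first exact: mulr_ge0.
by apply: ler_wpM2l => //; exact: norm_le_enorm.
Qed.

End layers.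

Lemma layer_sum_morphism J tau c
    (F : nat -> (power J Q -> R) -> hyperbolic R n -> R) :
  0 <= tau -> 0 <= c ->
  (forall m x, finite_comb (fun g => F m g x)) ->
  (forall m g x, tau <= 2 ^+ m * depth (pos x) -> F m g x = 0) ->
  (forall K g, 0 <= K -> bnd (A := power J Q) K g -> forall m x y,
     `|F m g x - F m g y| <= c * K * 2 ^+ m * `|pos x - pos y|) ->
  morphism (A := power J Q) (B := H)
    (fun g x => layer_sum tau (F^~ g) x - layer_sum tau (F^~ g) hyp_origin).
Proof.
move=> t0 c0 fF F0 FP; split=> [x|].
  by apply: finite_combB; exact: finite_comb_sum.
exists (16 * N * tau * c) => [|K g K0 gK]; first by rewrite !mulr_ge0.
split=> [|x y]; first by rewrite subrr.
rewrite opprB addrA subrK -[_ * c * K]mulrA.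
apply: layer_sum_lip => [//|m z||].
- exact: F0.
- exact: mulr_ge0.
- exact: FP.
Qed.

Let center m : 'rV[R]_n := (1 - (2 ^+ m)^-1) *: delta_mx 0 i0.
Let radius m : R := (2 ^+ m)^-1 / (8 * N).

Let radius_gt0 m : 0 < radius m.
Proof. by rewrite divr_gt0 ?invr_gt0// mulr_gt0// (lt_le_trans _ N1). Qed.

Let center_depth m : depth (center m) = (2 ^+ m)^-1.
Proof.
rewrite /depth enormZ enorm_delta mulr1 ger0_norm; first by ring.
by rewrite subr_ge0 invf_le1// exprn_ege1// ler1n.
Qed.

Let N_radius m : N * radius m = (2 ^+ m)^-1 / 8.
Proof.
have N0 : N != 0 by rewrite gt_eqF// (lt_le_trans _ N1).
by rewrite /radius; field; rewrite N0 gt_eqF.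
Qed.

Let near_center m v : `|(radius m)^-1 *: (v - center m)| < 2 ->
  3 / 4 < 2 ^+ m * depth v < 5 / 4.
Proof.
rewrite normrZ gtr0_norm ?invr_gt0// mulrC ltr_pdivrMr// => h.
have h2 : enorm (v - center m) < (2 ^+ m)^-1 / 4.
  apply: (le_lt_trans (enorm_le_norm _)).
  have : N * `|v - center m| < N * (2 * radius m).
    by rewrite ltr_pM2l// (lt_le_trans _ N1).
  by rewrite mulrCA N_radius; lra.
have := depth_lip v (center m); rewrite center_depth ler_norml => /andP[h3 h4].
have d1 : (2 ^+ m)^-1 * (3 / 4) < depth v by lra.
have d2 : depth v < (2 ^+ m)^-1 * (5 / 4) by lra.
move: d1 d2; rewrite -(ltr_pM2l (e0 m)) -[depth v < _](ltr_pM2l (e0 m)).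
by rewrite !mulVKf ?gt_eqF// => -> ->.
Qed.

(** The cubes are centred on a radius, at depth [2^-m], and have a size which is
    a small multiple of their depth; their doubles lie in disjoint ranges of
    depths, so that functions on the cubes are recovered by restriction. *)
Lemma cubes_retract_hyperbolic : retract (power nat Q) H.
Proof.
pose F m (g : power nat Q -> R) x : R :=
  let u : 'rV[R]_n := (radius m)^-1 *: (pos x - center m) in
  plateau u * g ((m, u) : nat * 'rV[R]_n).
have F0 m g x : 2 ^+ m * depth (pos x) <= 3 / 4 \/ 5 / 4 <= 2 ^+ m * depth (pos x) ->
    F m g x = 0.
  move=> h; rewrite /F plateau0 ?mul0r// leNgt; apply/negP => /near_center/andP[].
  by case: h; lra.
exists (fun g x => layer_sum (5 / 4) (fun m => F m g) x -
    layer_sum (5 / 4) (fun m => F m g) hyp_origin),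
  (fun f mu => f (B (center mu.1 + radius mu.1 *: cube_proj mu.2)) - f (B (center mu.1))).
split.
- apply: (@layer_sum_morphism _ _ (16 * N)) => //.
  + by move=> m x; apply: finite_combZ; exact: finite_comb_eval.
  + by move=> m g x h; apply: F0; right.
  + move=> K g K0 gK m x y.
    apply: (le_trans (plateau_mul_lip _ _ K0 (gK m))).
    rewrite -scalerBr opprB addrA subrK normrZ gtr0_norm ?invr_gt0//.
    rewrite le_eqVlt; apply/orP; left; apply/eqP; rewrite /radius; field.
    have N0 : N != 0 by rewrite gt_eqF// (lt_le_trans _ N1).
    by rewrite N0 expf_neq0.
- refine (@morphism_power R nat H Q (2 / 7) (fun m (f : H -> R) u =>
    f (B (center m + radius m *: cube_proj u)) - f (B (center m))) _ _ _) => //.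
  + by move=> m u; apply: finite_combB; exact: finite_comb_eval.
  + move=> m K f K0 fK; have a0 : 0 < (2 ^+ m)^-1 * (7 / 8) :> R.
      by rewrite mulr_gt0 ?invr_gt0.
    have := @hyperbolic_chart (center m) (radius m) _ a0 (ltW (radius_gt0 m)) _ _ _ K0 fK.
    rewrite -[2 * N * radius m]mulrA N_radius center_depth.
    have -> : 2 * ((2 ^+ m)^-1 / 8) / ((2 ^+ m)^-1 * (7 / 8)) = 2 / 7 :> R.
      by field; rewrite gt_eqF.
    by apply; lra.
- move=> g [K K0 gK]; apply/funext => -[m u] /=.
  have FE x : 3 / 4 < 2 ^+ m * depth (pos x) < 5 / 4 ->
      layer_sum (5 / 4) (fun j => F j g) x = F m g x.
    move=> /andP[x1 x2]; have dx := depth_gt0 x.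
    rewrite (@layer_sum_widen _ _ _ _ m.+1); last first.
    - by rewrite exprS; lra.
    - by move=> j z h; apply: F0; right.
    rewrite big_ord_recr/= big1 ?add0r// => j _; apply: F0; left.
    have : (2 : R) ^+ j.+1 * depth (pos x) <= 2 ^+ m * depth (pos x).
      by rewrite ler_pM2r// ler_eXn2l ?ltr1n.
    by rewrite exprS; lra.
  have small u' : `|u'| <= 1 -> let v := center m + radius m *: u' in
      pos (B v) = v /\ F m g (B v) = g (m, u') /\ 3 / 4 < 2 ^+ m * depth v < 5 / 4.
    move=> u1 v.
    have vE : (radius m)^-1 *: (v - center m) = u'.
      by rewrite /v addrAC subrr add0r scalerA mulVf ?scale1r// gt_eqF.
    have dv : 3 / 4 < 2 ^+ m * depth v < 5 / 4.
      by apply: near_center; rewrite vE; lra.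
    have v0 : 0 < depth v.
      by move: dv => /andP[h _]; rewrite -(pmulr_rgt0 _ (e0 m)); lra.
    have BvE := to_ball_depth v0; split=> //; split=> //.
    by rewrite /F BvE vE plateau1// mul1r.
  have [g0 gc _] := gK m.
  have [vE [Fv dv]] := small _ (cube_proj_le1 u).
  have [wE [Fw dw]] := small 0 ltac:(by rewrite normr0).
  move: wE Fw dw; rewrite scaler0 addr0 => wE Fw dw.
  by rewrite opprB addrA subrK !FE ?vE ?wE// Fv Fw gc g0 subr0.
Qed.

(** A node close to a point of the ball may lie outside the ball; the contraction
    moves it by a multiple of the mesh and puts it at depth at least a third of
    the mesh.  At level 0 all nodes are sent to the origin, where the flow of
    mass ends. *)
Definition grid_point m (i : @grid n m) : 'rV[R]_n :=
  if m is 0%N then 0 else (1 + 2 * N / 2 ^+ m)^-1 *: node i.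

Lemma grid_point_near m (i : @grid n m) x : hat i (pos x) != 0 ->
  `|pos x - grid_point i| <= (1 + 2 * N) / 2 ^+ m /\
  (2 ^+ m)^-1 / 3 <= depth (grid_point i).
Proof.
case: m i => [|m] i hx.
  rewrite subr0 expr0 invr1 mulr1 /depth enorm0; split; last by lra.
  by apply: (le_trans (ball_norm_le1 x)); have := N1; lra.
rewrite /grid_point; set h : R := (2 ^+ m.+1)^-1; set p := _ *: _.
have h0 : 0 < h by rewrite invr_gt0.
have h1 : h <= 1 by rewrite invf_le1// exprn_ege1// ler1n.
have Nh0 : 0 < N * h by rewrite mulr_gt0// (lt_le_trans _ N1).
have q0 : 0 < 1 + 2 * (N * h) by lra.
have nodeE : node i = (1 + 2 * (N * h)) *: p.
  by rewrite /p -/h -mulrA scalerA divff ?scale1r// gt_eqF.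
have xn := hat_supp hx; rewrite -/h in xn.
have en : enorm (node i) <= 1 + N * h.
  have -> : node i = pos x - (pos x - node i) by rewrite subKr.
  rewrite (le_trans (ler_enormD _ _))// enormN lerD//.
    by case: (x) => v v1; exact: ltW.
  by rewrite (le_trans (enorm_le_norm _))// ler_wpM2l.
have ep : (1 + 2 * (N * h)) * enorm p <= 1 + N * h.
  by move: en; rewrite nodeE enormZ gtr0_norm.
have p0 := enorm_ge0 p.
have p1 : enorm p <= 1 by nra.
split.
  have -> : pos x - p = (pos x - node i) + (2 * (N * h)) *: p.
    by rewrite nodeE scalerDl scale1r opprD addrA subrK.
  apply: (le_trans (ler_normD _ _)); rewrite -/h [leRHS]mulrDl mul1r.
  apply: lerD => //; rewrite normrZ ger0_norm; last by rewrite mulr_ge0// ltW.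
  rewrite -[2 * N * h]mulrA ler_piMr//; first by rewrite mulr_ge0// ltW.
  exact: le_trans (norm_le_enorm p) p1.
rewrite /depth; have : (1 + 2 * (N * h)) * (1 - enorm p) >= N * h by nra.
have := N1; set z := 1 - enorm p => hN hz.
have z0 : 0 <= z by rewrite subr_ge0.
suff : h * (1 + 2 * (N * h)) <= 3 * (N * h).
  move=> h3; rewrite ler_pdivrMr// -(ler_pM2r q0) (le_trans h3)//.
  by rewrite [leRHS](_ : _ = 3 * ((1 + 2 * (N * h)) * z)); [lra|ring].
nra.
Qed.

(** The value is such that a node close to a point of depth at least
    [sig / 2 / 2 ^+ m] is the centre of a cube of size [rad m], below, well inside
    the ball. *)
Let sig : R := 6 * N * (1 + 2 * N).

Let sig_ge : 18 * N <= sig.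
Proof. by rewrite /sig; have := N1; nra. Qed.

(** Equal to 1 at depths at most [sig / 2 ^+ m], and to 0 beyond twice that. *)
Definition layer_cutoff m v : R := clamp01 (2 - 2 ^+ m * depth v / sig).

Lemma layer_cutoff_lip m v p :
  `|layer_cutoff m v - layer_cutoff m p| <= 2 ^+ m * `|v - p|.
Proof.
have s0 : 0 < sig by have := sig_ge; have := N1; lra.
apply: (le_trans (clamp01_lip _ _)).
have -> : 2 - 2 ^+ m * depth v / sig - (2 - 2 ^+ m * depth p / sig) =
  2 ^+ m * ((depth p - depth v) / sig) by ring.
rewrite normrM (gtr0_norm (e0 m)) ler_pM2l// normrM (gtr0_norm (x := sig^-1)) ?invr_gt0//.
rewrite ler_pdivrMr// distrC (le_trans (depth_lip _ _))//.
rewrite (le_trans (enorm_le_norm _))// mulrC ler_wpM2l//.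
by have := sig_ge; have := N1; lra.
Qed.

Lemma layer_cutoff_le1 m v : `|layer_cutoff m v| <= 1.
Proof. by rewrite ger0_norm ?clamp01_ge0 ?clamp01_le1. Qed.

Lemma layer_cutoff_deep m v : 2 * sig <= 2 ^+ m * depth v -> layer_cutoff m v = 0.
Proof.
have s0 : 0 < sig by have := sig_ge; have := N1; lra.
by move=> h; apply: clamp01_0; rewrite subr_le0 ler_pdivlMr.
Qed.

Lemma layer_cutoff0 v : layer_cutoff 0 v = 1.
Proof.
have s0 : 0 < sig by have := sig_ge; have := N1; lra.
apply: clamp01_1; rewrite expr0 mul1r lerBrDr -lerBrDl ler_pdivrMr//.
by have := depth_le1 v; have := sig_ge; have := N1; lra.
Qed.

(** For varying [m], a partition of unity in the depth variable. *)
Definition layer_weight m v := layer_cutoff m v - layer_cutoff m.+1 v.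

Lemma layer_weight_supp m v : layer_weight m v != 0 -> sig / 2 <= 2 ^+ m * depth v.
Proof.
have s0 : 0 < sig by have := sig_ge; have := N1; lra.
move=> w0; rewrite leNgt; apply: contra w0 => h; rewrite /layer_weight.
rewrite /layer_cutoff !clamp01_1 ?subrr//.
  by rewrite lerBrDr -lerBrDl ler_pdivrMr// exprS; lra.
by rewrite lerBrDr -lerBrDl ler_pdivrMr//; lra.
Qed.

Lemma layer_weight_le1 m v : `|layer_weight m v| <= 1.
Proof.
have := clamp01_ge0 (2 - 2 ^+ m * depth v / sig).
have := clamp01_le1 (2 - 2 ^+ m * depth v / sig).
have := clamp01_ge0 (2 - 2 ^+ m.+1 * depth v / sig).
have := clamp01_le1 (2 - 2 ^+ m.+1 * depth v / sig).
rewrite /layer_weight /layer_cutoff => h1 h2 h3 h4.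
by rewrite ler_norml; apply/andP; split; lra.
Qed.

Lemma layer_weight_lip m v p :
  `|layer_weight m v - layer_weight m p| <= 3 * (2 ^+ m * `|v - p|).
Proof.
have -> : layer_weight m v - layer_weight m p =
  (layer_cutoff m v - layer_cutoff m p) - (layer_cutoff m.+1 v - layer_cutoff m.+1 p).
  by rewrite /layer_weight; ring.
rewrite (le_trans (ler_normB _ _))//.
have := layer_cutoff_lip m v p; have := layer_cutoff_lip m.+1 v p.
by rewrite exprS; lra.
Qed.

(** A Whitney piece for each node, and a pair of nodes of consecutive levels for
    each bounded scalar carried by the flow. *)
Definition piece_index : countType :=
  ({m & @grid n m} + {m & @grid n m.+1 * @grid n m})%type.

Definition whitney m (i : @grid n m) : piece_index :=
  inl (existT (fun m => @grid n m) m i).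

Definition edge m (i : @grid n m.+1) (j : @grid n m) : piece_index :=
  inr (existT (fun m => @grid n m.+1 * @grid n m)%type m (i, j)).

Let rad m : R := (1 + 2 * N) / 2 ^+ m.

Let rad_gt0 m : 0 < rad m.
Proof. by rewrite divr_gt0//; have := N1; lra. Qed.

Let linked (m : nat) (p q : 'rV[R]_n) : bool :=
  [&& (2 ^+ m)^-1 / 6 <= depth p, (2 ^+ m)^-1 / 6 <= depth q & `|p - q| <= 2 * rad m].

(** The data of [f]: its restrictions to the cubes around the nodes, and its
    differences between nodes of consecutive levels, each stored as a multiple of
    one fixed function on the cube.  Nodes whose cube comes too close to the
    sphere, and pairs of nodes that are not neighbours, get 0. *)
Definition analysis (f : hyperbolic R n -> R) (jv : piece_index * 'rV[R]_n) : R :=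
  match jv.1 with
  | inl (existT m i) => let p := grid_point i in
    if 2 * N * rad m <= depth p
    then f (B (p + rad m *: cube_proj jv.2)) - f (B p) else 0
  | inr (existT m (i, j)) => let p := grid_point i in let q := grid_point j in
    if linked m p q then cube_proj jv.2 0 i0 * (f (B p) - f (B q)) else 0
  end.

(** The edges rebuild the difference of the averages of two consecutive levels,
    and the cubes rebuild the difference between [f] and its average. *)
Definition synthesis_term m (g : power piece_index Q -> R) x : R :=
  layer_cutoff m.+1 (pos x) * (\sum_(i : @grid n m.+1) hat i (pos x) *
    \sum_(j : @grid n m) hat j (pos x) * g (edge i j, delta_mx 0 i0)) +
  layer_weight m (pos x) * \sum_(i : @grid n m) hat i (pos x) *
    g (whitney i, (rad m)^-1 *: (pos x - grid_point i)).

Lemma analysis_morphism :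
  morphism (A := H) (B := power piece_index Q) analysis.
Proof.
have K1 : 0 <= 24 * N * (1 + 2 * N) by rewrite !mulr_ge0// addr_ge0// mulr_ge0.
split=> [[[[m i]|[m [i j]]] v]|]; rewrite /analysis/=.
- case: (_ <= _); last exact: finite_comb0.
  by apply: finite_combB; exact: finite_comb_eval.
- case: (linked _ _ _); last exact: finite_comb0.
  by apply: finite_combZ; apply: finite_combB; exact: finite_comb_eval.
exists (2 + 24 * N * (1 + 2 * N)) => [|K f K0 fK]; first by rewrite addr_ge0.
have C0 : 0 <= (2 + 24 * N * (1 + 2 * N)) * K by rewrite mulr_ge0// addr_ge0.
case=> [[m i]|[m [i j]]]/=.
  case: (boolP (2 * N * rad m <= depth (grid_point i))) => hp; last exact: (bnd0 Q C0).
  have a0 : 0 < N * rad m by rewrite mulr_gt0// (lt_le_trans _ N1).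
  have := @hyperbolic_chart (grid_point i) (rad m) _ a0 (ltW (rad_gt0 m)) _ _ _ K0 fK.
  rewrite -[2 * N * rad m]mulrA mulfK ?gt_eqF// => h.
  by apply: bndW (h _); [rewrite ler_wpM2r// lerDl|lra].
case: (boolP (linked m (grid_point i) (grid_point j))) => hp; last exact: (bnd0 Q C0).
have /and3P[dp dq pq] := hp; set p := grid_point i in dp pq *.
set q := grid_point j in dq pq *; set D := f (B p) - f (B q).
have DK : `|D| <= 24 * N * (1 + 2 * N) * K.
  have a0 : 0 < (2 ^+ m)^-1 / 6 :> R by rewrite divr_gt0// invr_gt0.
  apply: (le_trans (lip_step K0 fK a0 dp dq)).
  apply: (@le_trans _ _ (2 * N / ((2 ^+ m)^-1 / 6) * K * (2 * rad m))).
    by rewrite ler_wpM2l// mulr_ge0// divr_ge0 ?mulr_ge0// ltW.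
  by rewrite le_eqVlt /rad; apply/orP; left; apply/eqP; field; rewrite gt_eqF.
split=> [|u|u v].
- by rewrite cube_proj0 mxE mul0r.
- by rewrite cube_projK.
rewrite -mulrBl normrM mulrC; apply: ler_pM => //.
  by apply: (le_trans DK); rewrite ler_wpM2r// lerDr.
have := coord_le_norm (cube_proj u - cube_proj v) i0; rewrite !mxE => h.
exact: le_trans h (cube_proj_lip u v).
Qed.

Let sums_to_1 m x : \sum_(i : @grid n m) hat i (pos x) = 1.
Proof. exact/hat_sum/ball_norm_le1. Qed.

Let hat_tv_pos m x y : \sum_(i : @grid n m) `|hat i (pos x) - hat i (pos y)| <=
  2 * N * 2 ^+ m * `|pos x - pos y|.
Proof. exact: hat_tv (ball_norm_le1 x) (ball_norm_le1 y). Qed.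

(** All the data are bounded by [K], and all the weights have slope of order
    [2 ^+ m] in total variation. *)
Lemma synthesis_term_lip K (g : power piece_index Q -> R) m x y :
  0 <= K -> bnd (A := power piece_index Q) K g ->
  `|synthesis_term m g x - synthesis_term m g y| <=
    (8 * N + 6) * K * 2 ^+ m * `|pos x - pos y|.
Proof.
move=> K0 gK; set d := `|pos x - pos y|; have d0 : 0 <= d by exact: normr_ge0.
have gle j v : `|g (j, v)| <= K by exact: cube_space_le K0 (gK j).
pose S z (i : @grid n m.+1) := \sum_(j : @grid n m) hat j (pos z) *
  g (edge i j, delta_mx 0 i0).
have SK z i : `|S z i| <= K.
  by apply: average_le => // j; exact: hat_ge0.
have Sl i : `|S x i - S y i| <= K * (2 * N * 2 ^+ m * d).
  have := @average_lip R (@grid n m) (fun j => hat j (pos x)) (fun j => hat j (pos y))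
    (fun j => g (edge i j, delta_mx 0 i0)) (fun j => g (edge i j, delta_mx 0 i0)) K 0
    (fun j => hat_ge0 j _) (sums_to_1 m x).
  move=> /(_ _ _)/le_trans; apply=> //; first by move=> j; rewrite subrr normr0.
  by rewrite add0r ler_wpM2l.
pose T z := \sum_(i : @grid n m.+1) hat i (pos z) * S z i.
have TK : `|T y| <= K.
  by apply: average_le => // j; exact: hat_ge0.
have Tl : `|T x - T y| <= K * (2 * N * 2 ^+ m * d) + K * (2 * N * 2 ^+ m.+1 * d).
  apply: (le_trans (@average_lip R (@grid n m.+1) (fun i => hat i (pos x))
    (fun i => hat i (pos y)) (S x) (S y) K _ (fun j => hat_ge0 j _)
    (sums_to_1 m.+1 x) Sl (SK y))).
  by rewrite lerD// ler_wpM2l.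
pose G z (i : @grid n m) := g (whitney i, (rad m)^-1 *: (pos z - grid_point i)).
have GK z i : `|G z i| <= K by exact: gle.
have Gl i : `|G x i - G y i| <= K * (2 ^+ m * d).
  have [_ _ gl] := gK (whitney i); apply: (le_trans (gl _ _)).
  rewrite ler_wpM2l// -scalerBr opprB addrA subrK normrZ gtr0_norm ?invr_gt0//.
  rewrite ler_wpM2r// /rad invfM invrK ler_piMl// ?(ltW (e0 m))//.
  by rewrite invf_le1; have := N1; lra.
pose U z := \sum_(i : @grid n m) hat i (pos z) * G z i.
have UK : `|U y| <= K.
  by apply: average_le => // j; exact: hat_ge0.
have Ul : `|U x - U y| <= K * (2 ^+ m * d) + K * (2 * N * 2 ^+ m * d).
  apply: (le_trans (@average_lip R (@grid n m) (fun i => hat i (pos x))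
    (fun i => hat i (pos y)) (G x) (G y) K _ (fun j => hat_ge0 j _)
    (sums_to_1 m x) Gl (GK y))).
  by rewrite lerD// ler_wpM2l.
rewrite /synthesis_term -/(T x) -/(T y) -/(U x) -/(U y) opprD addrACA.
apply: (le_trans (ler_normD _ _)).
have h1 := prod_lip (T x) (layer_cutoff m.+1 (pos y))
  (layer_cutoff_le1 m.+1 (pos x)) TK.
have h2 := prod_lip (U x) (layer_weight m (pos y)) (layer_weight_le1 m (pos x)) UK.
have h3 : K * `|layer_cutoff m.+1 (pos x) - layer_cutoff m.+1 (pos y)| <=
    K * (2 ^+ m.+1 * d) by rewrite ler_wpM2l// layer_cutoff_lip.
have h4 : K * `|layer_weight m (pos x) - layer_weight m (pos y)| <=
    K * (3 * (2 ^+ m * d)) by rewrite ler_wpM2l// layer_weight_lip.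
rewrite mul1r in h1; rewrite mul1r in h2; rewrite exprS in h3 Tl.
rewrite [leRHS](_ : _ =
  (K * (2 * N * 2 ^+ m * d) + K * (2 * N * (2 * 2 ^+ m) * d) +
   K * (2 * 2 ^+ m * d)) +
  (K * (2 ^+ m * d) + K * (2 * N * 2 ^+ m * d) + K * (3 * (2 ^+ m * d))));
  last by ring.
by apply: lerD; [apply: (le_trans h1)|apply: (le_trans h2)]; apply: lerD.
Qed.

Lemma synthesis_morphism :
  morphism (A := power piece_index Q) (B := H) (fun g x =>
    layer_sum (2 * sig) (synthesis_term^~ g) x -
    layer_sum (2 * sig) (synthesis_term^~ g) hyp_origin).
Proof.
have s0 : 0 <= sig by have := sig_ge; have := N1; lra.
apply: (@layer_sum_morphism piece_index _ (8 * N + 6) synthesis_term).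
- by rewrite mulr_ge0.
- by rewrite addr_ge0// mulr_ge0.
- move=> m x; apply: finite_combD; apply: finite_combZ; apply: finite_comb_sum => i.
    apply: finite_combZ; apply: finite_comb_sum => j; apply: finite_combZ.
    exact: finite_comb_eval.
  by apply: finite_combZ; exact: finite_comb_eval.
- move=> m g x deep.
  have deep1 : 2 * sig <= 2 ^+ m.+1 * depth (pos x).
    have : 0 <= 2 ^+ m * depth (pos x).
      by rewrite mulr_ge0 ?(ltW (e0 m))// ltW// depth_gt0.
    by rewrite exprS; lra.
  by rewrite /synthesis_term /layer_weight !layer_cutoff_deep// subrr !mul0r addr0.
- by move=> K g K0 gK m x y; exact: synthesis_term_lip.
Qed.

Definition grid_average (f : hyperbolic R n -> R) m x :=
  \sum_(i : @grid n m) hat i (pos x) * f (B (grid_point i)).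

(** Wherever a weight is nonzero, the corresponding datum has not been replaced
    by 0 and the point lies in the cube of the node. *)
Lemma synthesis_analysis_term (f : hyperbolic R n -> R) m x :
  synthesis_term m (analysis f) x =
    layer_cutoff m.+1 (pos x) * (grid_average f m.+1 x - grid_average f m x) +
    layer_weight m (pos x) * (f x - grid_average f m x).
Proof.
have h0 k : 0 < (2 ^+ k)^-1 :> R by rewrite invr_gt0.
rewrite /synthesis_term; congr (_ * _ + _).
  have -> : grid_average f m.+1 x - grid_average f m x =
      \sum_(i : @grid n m.+1) hat i (pos x) *
        \sum_(j : @grid n m) hat j (pos x) *
          (f (B (grid_point i)) - f (B (grid_point j))).
    under eq_bigr => i _.
      under eq_bigr => j _ do rewrite mulrBr.
      rewrite sumrB -mulr_suml sums_to_1 mul1r mulrBr.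
      over.
    by rewrite sumrB -mulr_suml sums_to_1 mul1r.
  apply: eq_bigr => i _; have [->|hi] := eqVneq (hat i (pos x)) 0.
    by rewrite !mul0r.
  congr (_ * _); apply: eq_bigr => j _; have [->|hj] := eqVneq (hat j (pos x)) 0.
    by rewrite !mul0r.
  congr (_ * _); rewrite /analysis/=.
  have [xi di] := grid_point_near hi; have [xj dj] := grid_point_near hj.
  have -> : linked m (grid_point i) (grid_point j).
    apply/and3P; split.
    - by move: di; rewrite exprS invfM; lra.
    - by have := h0 m; lra.
    - have -> : grid_point i - grid_point j =
        (pos x - grid_point j) - (pos x - grid_point i).
        by rewrite opprB [RHS]addrC addrA subrK.
      apply: (le_trans (ler_normB _ _)); rewrite mulr_natl mulr2n lerD//.
      apply: (le_trans xi); rewrite /rad exprS invfM.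
      have r0 : 0 < (1 + 2 * N) / 2 ^+ m := rad_gt0 m.
      by rewrite mulrCA ler_piMl ?(ltW r0)// invf_le1// ler1n.
  rewrite cube_projE; first by rewrite mxE !eqxx mul1r.
  by rewrite (le_trans (norm_le_enorm _))// enorm_delta.
have [->|w0] := eqVneq (layer_weight m (pos x)) 0; first by rewrite !mul0r.
congr (_ * _).
have -> : f x - grid_average f m x =
    \sum_(i : @grid n m) hat i (pos x) * (f x - f (B (grid_point i))).
  under [RHS]eq_bigr => i _ do rewrite mulrBr.
  by rewrite sumrB -mulr_suml sums_to_1 mul1r.
apply: eq_bigr => i _; have [->|hi] := eqVneq (hat i (pos x)) 0.
  by rewrite !mul0r.
congr (_ * _); rewrite /analysis/=; have [xi di] := grid_point_near hi.
have ws := layer_weight_supp w0.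
have -> : 2 * N * rad m <= depth (grid_point i).
  have dx : sig / 2 / 2 ^+ m <= depth (pos x).
    by rewrite ler_pdivrMr// [leRHS]mulrC.
  have := depth_near (v := grid_point i) (p := pos x) (r := rad m).
  rewrite distrC => /(_ xi); apply: le_trans.
  have -> : 2 * N * rad m = sig / 2 / 2 ^+ m - N * rad m.
    by rewrite /sig /rad; field; rewrite gt_eqF.
  by rewrite lerB.
rewrite cube_projE; last first.
  rewrite normrZ gtr0_norm ?invr_gt0 ?rad_gt0// mulrC ler_pdivrMr ?rad_gt0//.
  by rewrite mul1r.
by rewrite scalerA divff ?gt_eqF// scale1r [_ + (pos x - _)]addrC subrK to_ball_pos.
Qed.

(** The terms of [synthesis_analysis_term] telescope: they are the increments of
    [layer_cutoff m * (grid_average f m - f)], which is 0 for large [m], and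
    equal to [- f] for [m = 0] because [f] vanishes at the origin. *)
Lemma hyperbolic_retract_cubes : retract H (power nat Q).
Proof.
apply: (@retract_trans _ (power piece_index Q)); last first.
  exact: power_reindex (@pickleK piece_index).
exists analysis, (fun g x =>
    layer_sum (2 * sig) (synthesis_term^~ g) x -
    layer_sum (2 * sig) (synthesis_term^~ g) hyp_origin); split.
- exact: analysis_morphism.
- exact: synthesis_morphism.
move=> f [K K0 [f0 fK]].
suff sumE x : layer_sum (2 * sig) (synthesis_term^~ (analysis f)) x = f x.
  by apply/funext => x; rewrite !sumE f0 subr0.
pose T m := layer_cutoff m (pos x) * (grid_average f m x - f x).
rewrite /layer_sum (eq_bigr (fun m : 'I__ => T m.+1 - T m)); last first.
  by move=> m _; rewrite synthesis_analysis_term /T /layer_weight; ring.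
rewrite -(big_mkord xpredT (fun m => T m.+1 - T m)) telescope_sumr// /T.
rewrite layer_cutoff_deep; last by rewrite -ler_pdivrMr ?depth_gt0// le_exp_level.
rewrite layer_cutoff0 mul0r mul1r sub0r opprB.
suff -> : grid_average f 0 x = 0 by rewrite subr0.
have B0 : B 0 = hyp_origin by exact: (to_ball_pos hyp_origin).
by apply: big1 => i _; rewrite /grid_point B0 f0 mulr0.
Qed.

End hyperbolic_retracts.

(** * The isomorphism *)

Theorem theorem4 (R : realType) (n : nat) (hn : (2 <= n)%N)
    (o : hyperbolic R n) (p : euclidean R n) :
  isomorphic (LF o) (LF p).
Proof.
pose i0 := Ordinal (ltnW hn); apply: isom_LF.
apply: (isom_trans (lip_space_base o hyp_origin)).
apply: (isom_trans _ (lip_space_base (0%R : euclidean R n) p)).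
apply: (@isom_trans _ (power nat (power nat (cube_space R n)))).
  exact: pelczynski (hyperbolic_retract_cubes i0) (cubes_retract_hyperbolic i0).
apply: isom_sym.
exact: pelczynski euclidean_retract_cubes (cubes_retract_euclidean i0).
Qed.
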